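(* On the unweighted Bergman space $A^2(\mathbb{B}^n)$ of the unit ball $\mathbb{B}^n\subset\mathbb{C}^n$, let $\mu=\delta_0$ be the unit point mass at the origin. Then $T_\mu$ has rank one and hence belongs to $S_p(A^2(\mathbb{B}^n))$ for every $p>0$, while $$\widetilde\mu\in L^p(\mathbb{B}^n,d\lambda)\quad\Longleftrightarrow\quad p>\frac{n}{n+1}.$$ At the endpoint $p=\frac{n}{n+1}$ the integral $\int_{\mathbb{B}^n}\widetilde\mu(z)^p\,d\lambda(z)$ diverges.
   Context: $\mathbb{B}^n=\{z\in\mathbb{C}^n:|z|<1\}$, $dV$ is Lebesgue measure, and $A^2(\mathbb{B}^n)$ is the space of holomorphic functions in $L^2(\mathbb{B}^n,dV)$, with Bergman (reproducing) kernel $K(z,w)=c_n(1-\langle z,w\rangle)^{-(n+1)}$, where $c_n=1/|\mathbb{B}^n|$. $d\lambda(z)=K(z,z)\,dV(z)$, $k_z(w)=K(w,z)/\sqrt{K(z,z)}$. For a non-negative Borel measure $\mu$, $T_\mu f(z)=\int f(\zeta)K(z,\zeta)\,d\mu(\zeta)$ is the Toeplitz operator and $\widetilde\mu(z)=\langle T_\mu k_z,k_z\rangle=\frac{1}{K(z,z)}\int|K(z,w)|^2\,d\mu(w)$ is the Berezin transform. $S_p(H)$ is the set of compact operators on $H$ whose singular values are $p$-summable. *)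

(* Defs.v *)
From HB Require Import structures.
From mathcomp Require Import all_boot all_order all_algebra.
From mathcomp Require Import all_classical all_reals all_analysis.
From mathcomp Require Import measurable_realfun complex.

Set Implicit Arguments.
Unset Strict Implicit.
Unset Printing Implicit Defensive.

Import Order.TTheory GRing.Theory Num.Theory.
Import numFieldNormedType.Exports.

Local Open Scope classical_set_scope.
Local Open Scope ring_scope.

(* The library proves this too, but its instance of {sigma_finite_measure ...}
   for a product is not found by unification. *)
Lemma product_sigma_finite d1 d2 (T1 : measurableType d1)
    (T2 : measurableType d2) (R : realType)
    (m1 : {sigma_finite_measure set T1 -> \bar R})
    (m2 : {sigma_finite_measure set T2 -> \bar R}) :
  sigma_finite setT (m1 \x m2)%E.
Proof.
have /sigma_finiteP[F [TF ndF Foo]] := sigma_finiteT m1.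
have /sigma_finiteP[G [TG ndG Goo]] := sigma_finiteT m2.
exists (fun n => F n `*` G n).
  rewrite -setXTT TF TG predeqE => -[x y]; split.
    move=> [/= [n _ Fnx] [k _ Gky]]; exists (maxn n k) => //; split.
    - by move: x Fnx; exact/subsetPset/ndF/leq_maxl.
    - by move: y Gky; exact/subsetPset/ndG/leq_maxr.
  by move=> [n _ []/= ? ?]; split; exists n.
move=> k; have [? ?] := Foo k; have [? ?] := Goo k.
split; first exact: measurableX.
by rewrite product_measure1E// lte_mul_pinfty// ge0_fin_numE.
Qed.

Section tuple_measure.
Context d (T : measurableType d) (R : realType).
Variable mu : {sigma_finite_measure set T -> \bar R}.

Definition tcons n (xt : T * n.-tuple T) : n.+1.-tuple T :=
  [tuple of xt.1 :: xt.2].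

Lemma measurable_tcons n : measurable_fun setT (@tcons n).
Proof. exact: measurable_cons. Qed.

Lemma measurable_preimage_tcons n (A : set (n.+1.-tuple T)) :
  measurable A -> measurable (@tcons n @^-1` A).
Proof.
by move=> mA; rewrite -[X in measurable X]setTI; exact: measurable_tcons.
Qed.

Section step.
Context n (nu : {sigma_finite_measure set (n.-tuple T) -> \bar R}).
Local Open Scope ereal_scope.

Definition tuple_measureS : set (n.+1.-tuple T) -> \bar R :=
  pushforward (mu \x nu) (@tcons n).

Let tms0 : tuple_measureS set0 = 0.
Proof. by rewrite /tuple_measureS /pushforward preimage_set0 measure0. Qed.

Let tms_ge0 A : 0 <= tuple_measureS A.
Proof. by rewrite /tuple_measureS /pushforward; exact: measure_ge0. Qed.

Let tms_sigma_additive : semi_sigma_additive tuple_measureS.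
Proof.
move=> F mF tF mUF; rewrite /tuple_measureS /pushforward preimage_bigcup.
apply: measure_semi_sigma_additive.
- by move=> k; exact: measurable_preimage_tcons.
- apply/trivIsetP => i j _ _ ij; rewrite -preimage_setI.
  by move/trivIsetP : tF => /(_ _ _ _ _ ij) ->//; rewrite preimage_set0.
- by rewrite -preimage_bigcup; exact: measurable_preimage_tcons.
Qed.

HB.instance Definition _ := isMeasure.Build _ _ _ tuple_measureS
  tms0 tms_ge0 tms_sigma_additive.

Let tms_sigma_finite : sigma_finite setT tuple_measureS.
Proof.
have [F UF Foo] := product_sigma_finite mu nu.
pose g (t : n.+1.-tuple T) : T * n.-tuple T := (thead t, [tuple of behead t]).
have gK : cancel g (@tcons n) by move=> t; rewrite /g /tcons/= -tuple_eta.
have Kg : cancel (@tcons n) g.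
  move=> [x t]; rewrite /g /tcons/= theadE; congr pair.
  by apply/val_inj.
have mg : measurable_fun setT g.
  apply: measurable_fun_pair; last exact: measurable_behead.
  exact: measurable_tnth.
exists (fun k => g @^-1` F k).
  by rewrite -preimage_bigcup -UF preimage_setT.
move=> k; have [mF Fk] := Foo k; split.
  by rewrite -[X in measurable X]setTI; exact: mg.
rewrite /tuple_measureS /pushforward (_ : _ @^-1` _ = F k)//.
by apply/seteqP; split=> x /=; rewrite Kg.
Qed.

HB.instance Definition _ := Measure_isSigmaFinite.Build _ _ _ tuple_measureS
  tms_sigma_finite.

End step.

Fixpoint tuple_measure n : {sigma_finite_measure set (n.-tuple T) -> \bar R} :=
  if n is m.+1 then tuple_measureS (tuple_measure m)
  else \d_([tuple] : 0.-tuple T).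

End tuple_measure.

HB.instance Definition _ (R : realType) := NormedModule.copy R[i] R[i]^o.
HB.instance Definition _ (R : realType) := Pointed.copy R[i] R[i]^o.

(* 'rV[R[i]]_n is given the product sigma-algebra of its 2n real coordinates,
   that is, the Borel sigma-algebra of C^n. *)
Section complex_space.
Variables (R : realType) (n : nat).
Local Notation C := R[i].
Local Notation Cn := 'rV[C]_n.
Local Notation R2 := (measurableTypeR R * measurableTypeR R)%type.

Definition realify (z : Cn) : n.-tuple R2 :=
  [tuple (complex.Re (z 0 j), complex.Im (z 0 j)) | j < n].

Definition complexify (t : n.-tuple R2) : Cn :=
  \row_j ((tnth t j).1 +i* (tnth t j).2)%C.

Lemma realifyK : cancel realify complexify.
Proof.
move=> z; apply/rowP => j; rewrite mxE tnth_mktuple/=.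
by case: (z 0 j).
Qed.

Lemma complexifyK : cancel complexify realify.
Proof.
move=> t; apply: eq_from_tnth => j.
by rewrite tnth_mktuple !mxE/= -surjective_pairing.
Qed.

HB.instance Definition _ := Measurable.copy Cn
  (g_sigma_algebra_preimageType (realify : Cn -> n.-tuple R2)).

Lemma measurable_realify : measurable_fun setT realify.
Proof. by move=> _ B mB; rewrite setTI; exists B => //; rewrite setTI. Qed.

Lemma measurable_complexify : measurable_fun setT complexify.
Proof.
move=> _ _ [B mB <-]; rewrite !setTI -comp_preimage.
by rewrite (_ : realify \o complexify = idfun)//; apply/funext => t /=;
  rewrite complexifyK.
Qed.

Lemma measurable_Re_coord j :
  measurable_fun setT (fun z : Cn => complex.Re (z 0 j)).
Proof.
rewrite (_ : (fun _ => _) = fst \o (fun t => tnth t j) \o realify); last first.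
  by apply/funext => z /=; rewrite tnth_mktuple.
apply: measurableT_comp; last exact: measurable_realify.
by apply: measurableT_comp; [exact: measurable_fst|exact: measurable_tnth].
Qed.

Lemma measurable_Im_coord j :
  measurable_fun setT (fun z : Cn => complex.Im (z 0 j)).
Proof.
rewrite (_ : (fun _ => _) = snd \o (fun t => tnth t j) \o realify); last first.
  by apply/funext => z /=; rewrite tnth_mktuple.
apply: measurableT_comp; last exact: measurable_realify.
by apply: measurableT_comp; [exact: measurable_snd|exact: measurable_tnth].
Qed.

End complex_space.

Section volume.
Variable R : realType.
Local Open Scope ereal_scope.
Local Notation RR := (measurableTypeR R).

Definition plane_measure : set (RR * RR) -> \bar R :=
  (@lebesgue_measure R \x @lebesgue_measure R)%E.

HB.instance Definition _ := Measure.on plane_measure.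
HB.instance Definition _ := Measure_isSigmaFinite.Build _ _ _ plane_measure
  (product_sigma_finite (@lebesgue_measure R) (@lebesgue_measure R)).

Variable n : nat.

Definition volume : set 'rV[R[i]]_n -> \bar R :=
  pushforward (tuple_measure plane_measure n) (@complexify R n).

Let mpre (A : set 'rV[R[i]]_n) : measurable A ->
  measurable (@complexify R n @^-1` A).
Proof.
by move=> mA; rewrite -[X in measurable X]setTI; exact: measurable_complexify.
Qed.

Let volume0 : volume set0 = 0.
Proof. by rewrite /volume /pushforward preimage_set0 measure0. Qed.

Let volume_ge0 A : 0 <= volume A.
Proof. by rewrite /volume /pushforward; exact: measure_ge0. Qed.

Let volume_sigma_additive : semi_sigma_additive volume.
Proof.
move=> F mF tF mUF; rewrite /volume /pushforward preimage_bigcup.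
apply: measure_semi_sigma_additive.
- by move=> k; exact: mpre.
- apply/trivIsetP => i j _ _ ij; rewrite -preimage_setI.
  by move/trivIsetP : tF => /(_ _ _ _ _ ij) ->//; rewrite preimage_set0.
- by rewrite -preimage_bigcup; exact: mpre.
Qed.

HB.instance Definition _ := isMeasure.Build _ _ _ volume
  volume0 volume_ge0 volume_sigma_additive.

End volume.
Arguments volume R n : clear implicits.

Section integral.
Context d (T : measurableType d) (R : realType).

Definition cintegral (mu : {measure set T -> \bar R}) (D : set T)
    (f : T -> R[i]) : R[i] :=
  (\int[mu]_(x in D) complex.Re (f x) +i* \int[mu]_(x in D) complex.Im (f x))%C.

End integral.

(* Operators on a space H carrying the inner product ip.  H is a subspace of an
   ambient vector space V, and operators are maps V -> V of which only the
   values on H matter. *)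
Section operators.
Variables (R : realType) (V : lmodType R[i]) (ip : V -> V -> R[i]) (H : set V).
Implicit Types T S : V -> V.

Definition ipnorm (f : V) : R := Num.sqrt (complex.Re (ip f f)).

Definition linear_operator T :=
  (forall f, H f -> H (T f)) /\
  (forall (a : R[i]) f g, H f -> H g -> T (a *: f + g) = a *: T f + T g).

Definition compact_operator T :=
  linear_operator T /\
  forall u : nat -> V, (forall k, H (u k)) ->
    (exists M, forall k, ipnorm (u k) <= M) ->
    exists (phi : nat -> nat) (g : V),
      [/\ {homo phi : j k / (j < k)%N}, H g &
          ipnorm (T (u (phi k)) - g) @[k --> \oo] --> (0 : R)].

Definition adjoint_operator T S :=
  linear_operator S /\ forall f g, H f -> H g -> ip (T f) g = ip f (S g).

Definition has_dim (W : set V) (m : nat) := exists e : 'I_m -> V,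
  W = [set \sum_j c j *: e j | c in [set: 'I_m -> R[i]]] /\
  forall c : 'I_m -> R[i], \sum_j c j *: e j = 0 -> forall j, c j = 0.

Definition has_rank T (m : nat) := has_dim (T @` H) m.

(* s lists the square roots of the nonzero eigenvalues of T^* T in nonincreasing
   order, with multiplicity, padded with zeros if they are finitely many. *)
Definition singular_values T (s : nat -> R) :=
  exists2 S, adjoint_operator T S &
    [/\ nonincreasing_seq s, forall k, 0 <= s k &
        forall t : R, 0 < t -> exists2 m,
          has_dim [set f | H f /\ S (T f) = (t ^+ 2)%:C%C *: f] m &
          ([set k | s k = t] #= `I_m)%card].

Definition schatten (p : R) T :=
  compact_operator T /\
  exists2 s, singular_values T s &
    (\sum_(0 <= k <oo) (s k `^ p)%:E < +oo)%E.

End operators.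

Section bergman.
Variables (R : realType) (n : nat).
Local Notation C := R[i].
Local Notation Cn := 'rV[C]_n.
Local Notation normc := (@Normc.normc R).

Definition cdot (z w : Cn) : C := \sum_j z 0 j * conjc (w 0 j).

(* The Euclidean unit ball; the norm of 'rV[C]_n is the sup norm, which gives
   the same topology but a different ball. *)
Definition uball : set Cn := [set z | \sum_j normc (z 0 j) ^+ 2 < 1].

Definition extend0 (f : Cn -> C) : Cn -> C :=
  fun z => if z \in uball then f z else 0.

Definition holomorphic (f : Cn -> C) :=
  forall z, uball z -> differentiable f z.

Definition square_integrable (f : Cn -> C) :=
  [/\ measurable_fun uball (fun z => complex.Re (f z)),
      measurable_fun uball (fun z => complex.Im (f z)) &
      (\int[volume R n]_(z in uball) (normc (f z) ^+ 2)%:E < +oo)%E].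

(* A function on the ball is represented by its extension by 0 to C^n. *)
Definition A2 : set (Cn -> C) :=
  [set f | [/\ holomorphic f, square_integrable f &
               forall z, ~ uball z -> f z = 0]].

Definition ipA2 (f g : Cn -> C) : C :=
  cintegral (volume R n) uball (fun z => f z * conjc (g z)).

Definition bergman_cst : R := (fine (volume R n uball))^-1.

Definition bergman (z w : Cn) : C :=
  bergman_cst%:C%C * (1 - cdot z w) ^- n.+1.

Definition bergman_diag (z : Cn) : R := complex.Re (bergman z z).

Definition normalized_kernel (z : Cn) : Cn -> C :=
  extend0 (fun w => bergman w z / (Num.sqrt (bergman_diag z))%:C%C).

Definition toeplitz (mu : {measure set Cn -> \bar R}) (f : Cn -> C) : Cn -> C :=
  extend0 (fun z => cintegral mu uball (fun w => f w * bergman z w)).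

(* For a nonnegative measure the integral makes sense in [0, +oo]; it equals
   <T_mu k_z, k_z> whenever the latter is defined. *)
Definition berezin (mu : {measure set Cn -> \bar R}) (z : Cn) : \bar R :=
  ((bergman_diag z)^-1%:E *
   \int[mu]_(w in uball) (normc (bergman z w) ^+ 2)%:E)%E.

Definition lambda : set Cn -> \bar R :=
  fun A => (\int[volume R n]_(z in A `&` uball) (bergman_diag z)%:E)%E.

Local Notation rho z :=
  (1 - \sum_j (complex.Re (z 0 j) ^+ 2 + complex.Im (z 0 j) ^+ 2)).

Lemma sum_normc (z : Cn) : \sum_j normc (z 0 j) ^+ 2 =
  \sum_j (complex.Re (z 0 j) ^+ 2 + complex.Im (z 0 j) ^+ 2).
Proof.
apply: eq_bigr => j _; case: (z 0 j) => a b /=.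
by rewrite sqr_sqrtr// addr_ge0// sqr_ge0.
Qed.

Lemma cdot_diag (z : Cn) : cdot z z =
  (\sum_j (complex.Re (z 0 j) ^+ 2 + complex.Im (z 0 j) ^+ 2))%:C%C.
Proof.
rewrite rmorph_sum/=; apply: eq_bigr => j _.
case: (z 0 j) => a b; apply/eqP; rewrite eq_complex/=.
by apply/andP; split; apply/eqP; rewrite ?mulrN ?opprK -?expr2// mulrC addNr.
Qed.

Lemma bergman_diagE (z : Cn) : bergman_diag z = bergman_cst * rho z ^- n.+1.
Proof.
rewrite /bergman_diag /bergman cdot_diag.
by rewrite -(rmorph1 (real_complex R)) -rmorphB -rmorphXn -fmorphV -rmorphM.
Qed.

Lemma measurable_rho : measurable_fun setT (fun z : Cn => rho z).
Proof.
apply: measurable_funB => //; apply: measurable_sum => j.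
by apply: measurable_funD; apply: measurable_funX;
  [exact: measurable_Re_coord|exact: measurable_Im_coord].
Qed.

Lemma measurable_uball : measurable uball.
Proof.
rewrite (_ : uball = setT `&` (fun z : Cn => rho z) @^-1` `]0, +oo[).
  exact: measurable_rho.
rewrite setTI; apply/seteqP; split=> z /=; rewrite /uball/= sum_normc.
  by rewrite in_itv/= andbT subr_gt0.
by rewrite in_itv/= andbT subr_gt0.
Qed.

Lemma measurable_bergman_diag : measurable_fun uball bergman_diag.
Proof.
apply: (@eq_measurable_fun _ _ _ _ _
    (fun z : Cn => bergman_cst * (rho z `^ (-1)) ^+ n.+1)) => [z|].
  rewrite inE /uball/= sum_normc => z1.
  by rewrite bergman_diagE powR_inv1 ?exprVn// subr_ge0 ltW.
apply: (measurable_funS measurableT) => //.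
apply: measurable_funM => //; apply: measurable_funX.
by apply: (measurableT_comp (measurable_powR _)); exact: measurable_rho.
Qed.

Lemma bergman_diag_ge0 z : uball z -> 0 <= bergman_diag z.
Proof.
rewrite /uball/= sum_normc => z1; rewrite bergman_diagE mulr_ge0//.
  by rewrite invr_ge0 fine_ge0// measure_ge0.
by rewrite invr_ge0 exprn_ge0// subr_ge0 ltW.
Qed.

Let lambda0 : lambda set0 = 0%E.
Proof. by rewrite /lambda set0I integral_set0. Qed.

Let lambda_ge0 A : (0 <= lambda A)%E.
Proof.
by apply: integral_ge0 => z [_ zB]; rewrite lee_fin bergman_diag_ge0.
Qed.

Let lambda_sigma_additive : semi_sigma_additive lambda.
Proof.
move=> F mF tF mUF.
have -> : lambda (\bigcup_k F k) = (\sum_(k <oo) lambda (F k))%E.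
  rewrite /lambda setI_bigcupl ge0_integral_bigcup//.
  - by move=> k; apply: measurableI => //; exact: measurable_uball.
  - apply/measurable_EFinP.
    apply: (measurable_funS measurable_uball) measurable_bergman_diag.
    by move=> z [k _ []].
  - by move=> z [k _ [_ zB]]; rewrite lee_fin bergman_diag_ge0.
  - exact: trivIset_setIr.
exact: is_cvg_nneseries.
Qed.

HB.instance Definition _ := isMeasure.Build _ _ _ lambda
  lambda0 lambda_ge0 lambda_sigma_additive.

Definition Lp_lambda (p : R) (g : Cn -> \bar R) :=
  measurable_fun uball g /\
  (\int[lambda]_(z in uball) (`|g z| `^ p) < +oo)%E.

End bergman.

(* Main.v *)
From HB Require Import structures.
Require Import Defs.
From mathcomp Require Import all_boot all_order all_algebra.
From mathcomp Require Import all_classical all_reals all_analysis.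
From mathcomp Require Import measurable_realfun complex.
From mathcomp Require Import ring lra.

Set Implicit Arguments.
Unset Strict Implicit.
Unset Printing Implicit Defensive.

Import Order.TTheory GRing.Theory Num.Theory.
Import numFieldNormedType.Exports.

Local Open Scope classical_set_scope.
Local Open Scope ring_scope.

(* With c = 1 / |B| = K(z, 0) one has T f = c f(0) 1_B, so T has rank one. It is
   self-adjoint, with c as its only nonzero singular value, because <1, f> =
   conj f(0) / c, which is the mean value property: the volume of the ball is
   invariant under z |-> e^{it} z, so by Fubini the integral of f over B is the
   integral of its circle means, and each circle mean is f(0) by Goursat's
   theorem applied to f(e^{s+it} z) on [s, 0] x [0, 2 pi] as s tends to -oo.

   The Berezin transform at z is c rho^(n+1) with rho = 1 - |z|^2, while K(z, z)
   = c rho^-(n+1). On the shell 2^-(k+1) < rho <= 2^-k, whose volume is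
   comparable to 2^-k since |{|z|^2 < t}| = t^n |B|, the integral of its p-th
   power against lambda is comparable to 2^-(k ((n+1) p - n)); this geometric
   series converges if and only if p > n / (n+1). *)

(** * Invariance properties of Lebesgue measure *)

(** The volume of [C^n] is an iterated product of Lebesgue measure on the line, so its invariance
    under z |-> e^{it} z has to come from dimension one: translations and dilations of the line pass
    to products by a Fubini argument for maps (x, y) |-> (f x, g_x y), and a plane rotation is a
    product of shears of that kind. Holomorphy is complex differentiability at each point of the
    ball, with no continuity of the derivative assumed; hence Goursat's bisection rather than
    Green's formula. In the coordinate zeta = s + i t = log z a circle becomes a vertical segment,
    and g dzeta has imaginary part Im g ds + Re g dt. The several variables enter only through the
    slices b |-> f(b z), which are differentiable on the closed unit disc for every z in the ball.
    Since K(z, 0) is constant, the reproducing formula at the origin is the mean value property. It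
    gives self-adjointness, a bound on |f(0)| over norm-bounded sets, and through that bound
    compactness. *)

Section lebesgue_invariance.
Variable R : realType.
Local Notation RR := (measurableTypeR R).
Local Notation leb := (@lebesgue_measure R).

(** Lebesgue measure is determined by its values on the intervals []a, b]], so only the pushforward
    of these has to be computed. *)
Lemma lebesgue_measure_translation (s : R) (A : set RR) : measurable A ->
  leb ((fun x => x + s) @^-1` A) = leb A.
Proof.
move=> mA.
have mf : measurable_fun setT (fun x : RR => x + s : RR).
  by apply: measurable_funD => //; exact: measurable_id.
pose F : {mfun RR >-> RR} := HB.pack (fun x : RR => x + s : RR)
  (isMeasurableFun.Build _ _ _ _ _ mf).
rewrite -[LHS]/(pushforward leb F A); apply/esym.
apply: (@lebesgue_measure_unique R (pushforward leb F)) => //= _ [[a b]] _ <-.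
rewrite /pushforward/= (_ : _ @^-1` _ = `](a - s), (b - s)]%classic);
  last first.
  by apply/seteqP; split=> x /=; rewrite !in_itv/= ltrBlDr lerBrDr.
rewrite !lebesgue_measure_itv/= !lte_fin ltrD2r.
by case: ifP => // _; rewrite -!EFinB; congr EFin; ring.
Qed.

(** For positive [r] the pushforward multiplied by [r] has the right values on intervals; negative
    [r] is reduced to this case by the reflection x |-> - x. *)
Lemma lebesgue_measure_scaling (r : R) (A : set RR) : r != 0 -> measurable A ->
  leb ((fun x => r * x) @^-1` A) = (`|r|^-1%:E * leb A)%E.
Proof.
wlog : r A / 0 < r => [H r0 mA|r0 _ mA].
  have [rp|rn|/eqP] := ltgtP 0 r; [exact: H| |by rewrite eq_sym (negbTE r0)].
  rewrite (_ : _ @^-1` _ = (fun x => - r * x) @^-1` (-%R @^-1` A)); last first.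
    by apply/seteqP; split=> x /=; rewrite mulNr opprK.
  have mNA : measurable ((-%R : RR -> RR) @^-1` A).
    have mN : measurable_fun setT (-%R : RR -> RR) by exact: measurable_funN.
    by rewrite -[X in measurable X]setTI; exact: mN.
  rewrite H ?oppr_eq0// ?oppr_gt0// normrN; congr (_ * _)%E.
  exact: lebesgue_measureN.
have mf : measurable_fun setT (fun x : RR => r * x : RR).
  by apply: measurable_funM => //; exact: measurable_id.
pose F : {mfun RR >-> RR} := HB.pack (fun x : RR => r * x : RR)
  (isMeasurableFun.Build _ _ _ _ _ mf).
have r0' : (0 <= r)%R by exact: ltW.
rewrite (gtr0_norm r0).
have H : leb A = (r%:E * pushforward leb F A)%E.
  apply: (@lebesgue_measure_unique R (mscale (NngNum r0') (pushforward leb F)))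
    =>
    //= _ [[a b]] _ <-.
  rewrite /mscale/= /pushforward/=.
  rewrite (_ : _ @^-1` _ = `](a / r), (b / r)]%classic); last first.
    apply/seteqP; split=> x /=; rewrite !in_itv/=;
    by rewrite ltr_pdivrMr// ler_pdivlMr// mulrC.
  rewrite !lebesgue_measure_itv/= !lte_fin ltr_pM2r ?invr_gt0//.
  case: ifP => // _; last by rewrite mule0.
  by rewrite -!EFinB -EFinM; congr EFin; field; exact: lt0r_neq0.
by rewrite H muleA -EFinM mulVf ?lt0r_neq0// mul1e.
Qed.

End lebesgue_invariance.

Section skew_product.
Context d1 d2 (T1 : measurableType d1) (T2 : measurableType d2) (R : realType).
Variable m1 : {sigma_finite_measure set T1 -> \bar R}.
Variable m2 : {sigma_finite_measure set T2 -> \bar R}.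
Local Open Scope ereal_scope.

(** The section at x of the preimage is the preimage under [g x] of the section of [A] at [f x], so
    the two scaling laws act one after the other in the iterated integral. Letting [g] depend on x
    covers shears as well as dilations. *)
Lemma product_measure_skew (f : T1 -> T1) (g : T1 -> T2 -> T2) (k1 k2 : R)
    (A : set (T1 * T2)) :
  (0 <= k1)%R -> (0 <= k2)%R ->
  measurable_fun setT f ->
  (forall B, measurable B -> m1 (f @^-1` B) = k1%:E * m1 B) ->
  (forall x B, measurable B -> m2 (g x @^-1` B) = k2%:E * m2 B) ->
  measurable A ->
  (m1 \x m2) ((fun xy => (f xy.1, g xy.1 xy.2)) @^-1` A) =
  (k1 * k2)%:E * (m1 \x m2) A.
Proof.
move=> k10 k20 mf f_scale g_scale mA; rewrite /product_measure1/=.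
transitivity (\int[m1]_x (k2%:E * m2 (xsection A (f x)))).
  apply: eq_integral => x _; rewrite -(g_scale x);
    last exact: measurable_xsection.
  by congr (m2 _); apply/seteqP; split=> y /=; rewrite /xsection/= !inE.
have mS : measurable_fun setT (m2 \o xsection A).
  exact: measurable_fun_xsection.
rewrite ge0_integralZl_EFin//; last first.
  by apply: (measurableT_comp mS).
pose F : {mfun T1 >-> T1} := HB.pack f (isMeasurableFun.Build _ _ _ _ _ mf).
have := @ge0_integral_pushforward _ _ _ _ _ _ mf m1 setT (m2 \o xsection A)
  measurableT mS (fun _ _ => measure_ge0 _ _).
rewrite preimage_setT => <-.
rewrite (_ : \int[_]_(_ in _) _ = \int[mscale (NngNum k10) m1]_y m2 (xsection A
  y)).
  by rewrite ge0_integral_mscale//= mulrC EFinM muleA.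
by apply: eq_measure_integral => //= B mB _; rewrite /pushforward f_scale.
Qed.

Lemma product_measure_swap (A : set (T1 * T2)) : measurable A ->
  (m2 \x m1) (@swap_pair _ _ @^-1` A) = (m1 \x m2) A.
Proof.
move=> mA.
have mS : measurable_fun setT (@swap_pair T2 T1) by exact: measurable_fun_pair.
pose F : {mfun (T2 * T1)%type >-> (T1 * T2)%type} := HB.pack (@swap_pair T2 T1)
  (isMeasurableFun.Build _ _ _ _ _ mS).
rewrite (@product_measure_unique _ _ _ _ _ m1 m2 (pushforward (m2 \x m1) F))//.
move=> B C mB mC; transitivity ((m2 \x m1) (C `*` B)).
  rewrite /pushforward; congr (product_measure1 _ _ _).
  by apply/seteqP; split=> -[x y] /= [].
by rewrite product_measure1E// muleC.
Qed.

End skew_product.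

Section plane.
Variable R : realType.
Local Notation RR := (measurableTypeR R).
Local Notation pm := (@plane_measure R).
Local Notation leb := (@lebesgue_measure R).
Implicit Types A : set (RR * RR).

Lemma plane_measure_scaling (r : R) A : r != 0 -> measurable A ->
  pm ((fun xy => (r * xy.1, r * xy.2)) @^-1` A) = ((r ^- 2)%:E * pm A)%E.
Proof.
move=> r0 mA; rewrite -[r ^- 2](_ : `|r|^-1 * `|r|^-1 = _); last first.
  by rewrite -invfM -expr2 real_normK// num_real.
apply: (product_measure_skew (f := fun x : RR => r * x : RR)
  (g := fun _ : RR => (fun y : RR => r * y : RR))) => //; rewrite ?invr_ge0//.
- by apply: measurable_funM.
- by move=> B mB; exact: lebesgue_measure_scaling.
- by move=> _ B mB; exact: lebesgue_measure_scaling.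
Qed.

Lemma plane_measure_shearr (s : R) A : measurable A ->
  pm ((fun xy => (xy.1, xy.2 + s * xy.1)) @^-1` A) = pm A.
Proof.
move=> mA; rewrite -[RHS]mul1e -[1%R in RHS]mulr1.
apply: (product_measure_skew (f := idfun)
  (g := fun x : RR => (fun y : RR => y + s * x : RR))) => //.
- exact: measurable_id.
- by move=> B mB; rewrite mul1e.
- by move=> x B mB; rewrite mul1e; exact: lebesgue_measure_translation.
Qed.

Lemma plane_measure_swap A : measurable A ->
  pm (@swap_pair _ _ @^-1` A) = pm A.
Proof. exact: product_measure_swap. Qed.

Lemma measurable_shearr (s : R) A : measurable A ->
  measurable ((fun xy : RR * RR => (xy.1, xy.2 + s * xy.1) : RR * RR) @^-1` A).
Proof.
move=> mA; rewrite -[X in measurable X]setTI.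
suff: measurable_fun setT
  (fun xy : RR * RR => (xy.1, xy.2 + s * xy.1) : RR * RR) by exact.
apply: measurable_fun_pair => //; apply: measurable_funD => //.
by apply: measurable_funM.
Qed.

Lemma measurable_swap_pair A : measurable A ->
  measurable (@swap_pair _ _ @^-1` A).
Proof.
move=> mA; rewrite -[X in measurable X]setTI.
suff: measurable_fun setT (@swap_pair RR RR) by exact.
exact: measurable_fun_pair.
Qed.

Lemma measurable_shearl (s : R) A : measurable A ->
  measurable ((fun xy : RR * RR => (xy.1 + s * xy.2, xy.2) : RR * RR) @^-1` A).
Proof.
move=> mA; rewrite -[X in measurable X]setTI.
suff: measurable_fun setT
  (fun xy : RR * RR => (xy.1 + s * xy.2, xy.2) : RR * RR) by exact.
apply: measurable_fun_pair => //; apply: measurable_funD => //.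
by apply: measurable_funM.
Qed.

(** Conjugating the other shear by the exchange of coordinates. *)
Lemma plane_measure_shearl (s : R) A : measurable A ->
  pm ((fun xy => (xy.1 + s * xy.2, xy.2)) @^-1` A) = pm A.
Proof.
move=> mA.
rewrite -(plane_measure_swap mA) -(plane_measure_shearr s (measurable_swap_pair
  mA)).
rewrite -[RHS]plane_measure_swap//.
by apply: measurable_shearr; exact: measurable_swap_pair.
Qed.

(* A rotation by an angle other than pi is a product of three shears. *)
Lemma plane_measure_rotation (a b : R) A : a ^+ 2 + b ^+ 2 =
  1 -> measurable A ->
  pm ((fun xy => (a * xy.1 - b * xy.2, a * xy.2 + b * xy.1)) @^-1` A) = pm A.
Proof.
move=> ab1 mA; have [a1|a1] := eqVneq a (-1).
  have b0 : b = 0.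
    by apply/eqP; rewrite -sqrf_eq0; apply/eqP; move: ab1; rewrite a1; lra.
  have N0 : (-1 : R) != 0 by rewrite oppr_eq0.
  have := plane_measure_scaling N0 mA; rewrite sqrrN expr1n invr1 mul1e => <-.
  by congr (pm _); apply/seteqP; split=> -[x y] /=;
    rewrite a1 b0 !mul0r subr0 addr0.
have a1' : 1 + a != 0 by rewrite addrC addr_eq0.
(* For a = cos theta and b = sin theta this is tan (theta / 2). The rotation is then the shear x - t
   y, followed by y + b x, followed by x - t y again. *)
pose t := b / (1 + a).
have bE : b = t * (1 + a) by rewrite /t divfK.
have aE : a = 1 - b * t.
  apply: (mulIf a1'); rewrite mulrBl -mulrA -bE -expr2.
  by apply/eqP; rewrite -subr_eq0; apply/eqP; move: ab1; lra.
have m1 := measurable_shearl (- t) mA.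
have m2 := measurable_shearr b m1.
rewrite -(plane_measure_shearl (- t) mA) -(plane_measure_shearr b m1).
rewrite -(plane_measure_shearl (- t) m2).
have e2 x y : y + b * (x + - t * y) = a * y + b * x by rewrite {1}aE; ring.
have e1 x y : x + - t * y + - t * (a * y + b * x) = a * x - b * y.
  transitivity (x * (1 - b * t) - y * (t * (1 + a))); first by ring.
  by rewrite -aE -bE; ring.
by congr (pm _); apply/seteqP; split=> -[x y] /=; rewrite e2 e1.
Qed.

End plane.

(** * Scaling and boxes in the iterated product measure *)

Section tuple_measure_theory.
Context d (T : measurableType d) (R : realType).
Variable mu : {sigma_finite_measure set T -> \bar R}.
Local Open Scope ereal_scope.

(** By induction: under [tcons], [map_tuple f] on n+1 entries is the product of [f] and
    [map_tuple f] on n entries, and each entry contributes one factor [k]. *)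
Lemma tuple_measure_map (f : T -> T) (k : R) n (A : set (n.-tuple T)) :
  (0 <= k)%R -> measurable_fun setT f ->
  (forall B, measurable B -> mu (f @^-1` B) = k%:E * mu B) ->
  measurable A ->
  tuple_measure mu n (map_tuple f @^-1` A) = (k ^+ n)%:E * tuple_measure mu n A.
Proof.
move=> k0 mf f_scale; elim: n A => [|n IH] A mA.
  rewrite expr0 mul1e/= /dirac !indicE; congr (_%:R%:E).
  by congr nat_of_bool; apply/idP/idP; rewrite !inE/= [map_tuple _ _]tuple0.
rewrite /= /tuple_measureS /pushforward exprS.
rewrite -(product_measure_skew (f := f) (g := fun _ => map_tuple f))//.
- congr (product_measure1 _ _ _).
  have E (x : T) (t : n.-tuple T) :
      map_tuple f (tcons (x, t)) = tcons (f x, map_tuple f t) by exact/val_inj.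
  by apply/seteqP; split=> -[x t]/=; rewrite E.
- exact: exprn_ge0.
- exact: measurable_preimage_tcons.
Qed.

Lemma tuple_measure_box (B : set T) n : measurable B ->
  tuple_measure mu n [set t | forall i, B (tnth t i)] = mu B ^+ n.
Proof.
move=> mB; elim: n => [|n IH].
  rewrite expe0/= diracE (_ : (_ \in _) = true)//.
  by apply/mem_set => -[].
rewrite expeS /= /tuple_measureS /pushforward.
rewrite (_ : tcons (n:=n) @^-1` _ = B `*` [set t | forall i, B (tnth t i)]).
  rewrite product_measure1E ?IH//.
  rewrite (_ : mkset _ = \bigcap_(i in [set: 'I_n]) ((fun t =>
    tnth t i) @^-1` B)).
    apply: fin_bigcap_measurable => // i _.
    by rewrite -[X in measurable X]setTI; exact: measurable_tnth.
  by apply/seteqP; split=> t /= Bt i => [_|]; exact: Bt.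
apply/seteqP; split=> -[x t]/=.
  move=> H; split; first by have := H ord0.
  by move=> i; have := H (lift ord0 i); rewrite /tcons tnthS.
by move=> [Bx Bt] i; case: (unliftP ord0 i) => [j|] -> //; rewrite /tcons tnthS.
Qed.

End tuple_measure_theory.

(** * Rotations, dilations and volumes of balls in [C^n] *)

Section volume_theory.
Variables (R : realType) (n : nat).
Local Notation C := R[i].
Local Notation Cn := 'rV[C]_n.
Local Notation normc := (@Normc.normc R).
Local Notation RR := (measurableTypeR R).
Local Notation vol := (volume R n).

Lemma volumeE (A : set Cn) : vol A = tuple_measure (@plane_measure R) n
  (@complexify R n @^-1` A).
Proof. by []. Qed.

Lemma measurable_preimage_complexify (A : set Cn) : measurable A ->
  measurable (@complexify R n @^-1` A).
Proof.
by move=> mA; rewrite -[X in measurable X]setTI; exact: measurable_complexify.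
Qed.

Lemma volume_map (f : Cn -> Cn) (g : RR * RR -> RR * RR) (k : R) (A : set Cn) :
  0 <= k -> measurable_fun setT g ->
  (forall t, f (complexify t) = complexify (map_tuple g t)) ->
  (forall B, measurable B ->
    plane_measure (g @^-1` B) = (k%:E * plane_measure B)%E) ->
  measurable A ->
  vol (f @^-1` A) = ((k ^+ n)%:E * vol A)%E.
Proof.
move=> k0 mg fg g_scale mA; rewrite !volumeE.
rewrite -(tuple_measure_map (mu := @plane_measure R) (f := g))//.
  by congr (tuple_measure _ _ _); apply/seteqP; split=> t /=; rewrite fg.
exact: measurable_preimage_complexify.
Qed.

Lemma volume_rotation (a b : R) (A : set Cn) : a ^+ 2 + b ^+ 2 =
  1 -> measurable A ->
  vol ((fun z : Cn => (a +i* b)%C *: z) @^-1` A) = vol A.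
Proof.
move=> ab1 mA.
rewrite (@volume_map _ (fun xy => (a * xy.1 - b * xy.2,
  a * xy.2 + b * xy.1)) 1)//.
- by rewrite expr1n mul1e.
- by apply: measurable_fun_pair; [apply: measurable_funB|apply:
  measurable_funD];
    apply: measurable_funM.
- by move=> t; apply/rowP => j; rewrite !mxE tnth_map/=.
- by move=> B mB; rewrite mul1e plane_measure_rotation.
Qed.

Lemma volume_scaling (r : R) (A : set Cn) : r != 0 -> measurable A ->
  vol ((fun z : Cn => r%:C%C *: z) @^-1` A) = (((r ^- 2) ^+ n)%:E * vol A)%E.
Proof.
move=> r0 mA.
rewrite (@volume_map _ (fun xy => (r * xy.1, r * xy.2)) (r ^- 2))//.
- by rewrite invr_ge0 sqr_ge0.
- by apply: measurable_fun_pair; apply: measurable_funM.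
- move=> t; apply/rowP => j; rewrite !mxE tnth_map/=.
  by apply/eqP; rewrite eq_complex/= !mul0r subr0 addr0 !eqxx.
- by move=> B mB; rewrite plane_measure_scaling.
Qed.

Definition sqnorm (z : Cn) : R := \sum_j normc (z 0 j) ^+ 2.

Lemma uballE z : uball z = (sqnorm z < 1) :> Prop.
Proof. by []. Qed.

Lemma sqnorm_ge0 z : 0 <= sqnorm z.
Proof. by apply: sumr_ge0 => j _; exact: sqr_ge0. Qed.

Lemma sqnormZ (a : C) z : sqnorm (a *: z) = normc a ^+ 2 * sqnorm z.
Proof.
by rewrite /sqnorm mulr_sumr; apply: eq_bigr => j _;
  rewrite mxE Normc.normcM exprMn.
Qed.

Lemma measurable_sqnorm : measurable_fun setT sqnorm.
Proof.
rewrite (_ : sqnorm = fun z =>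
    \sum_j (complex.Re (z 0 j) ^+ 2 + complex.Im (z 0 j) ^+ 2)); last first.
  by apply/funext => z; exact: sum_normc.
apply: measurable_sum => j.
by apply: measurable_funD; apply: measurable_funX;
  [exact: measurable_Re_coord|exact: measurable_Im_coord].
Qed.

Lemma measurable_sqnorm_lt (t : R) : measurable [set z | sqnorm z < t].
Proof.
rewrite (_ : [set _ | _] = setT `&` sqnorm @^-1` `]-oo, t[); last first.
  by rewrite setTI; apply/seteqP; split=> z /=; rewrite in_itv.
exact: measurable_sqnorm.
Qed.

(** This set is the preimage of the unit ball under the dilation by 1 / sqrt t; the real dimension
    2n turns the square root into [t ^+ n]. *)
Lemma volume_sqnorm_lt (t : R) : 0 < t ->
  vol [set z | sqnorm z < t] = ((t ^+ n)%:E * vol (@uball R n))%E.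
Proof.
move=> t0; have st0 : (Num.sqrt t)^-1 != 0 by rewrite invr_eq0 gt_eqF//
  sqrtr_gt0.
rewrite -[t in X in (X%:E * _)%E]sqr_sqrtr ?ltW// -[Num.sqrt t in RHS]invrK
  exprVn.
rewrite -volume_scaling//; last exact: measurable_uball.
congr (vol _); apply/seteqP; split=> z/=; rewrite uballE sqnormZ/=;
by rewrite expr0n/= addr0 sqrtr_sqr real_normK ?num_real// exprVn sqr_sqrtr
  ?ltW//
  ltr_pdivrMl// mulr1.
Qed.

Lemma volume_box (e : R) : 0 < e ->
  vol [set z | forall j, -e < complex.Re (z 0 j) < e /\ -e < complex.Im (z 0 j)
    < e]
  = (((e *+ 2) ^+ 2) ^+ n)%:E.
Proof.
move=> e0; rewrite volumeE.
rewrite (_ : _ @^-1` _ = [set t | forall i,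
    (`]-e, e[ `*` `]-e, e[) (tnth t i)]); last first.
  apply/seteqP; split=> t /= H j; have := H j; rewrite !mxE/= !in_itv/=.
    by move=> [].
  by move=> [].
rewrite tuple_measure_box; last exact: measurableX.
rewrite EFin_expe; congr (_ ^+ _)%E.
transitivity (@lebesgue_measure R (`](-e)%R, e[%classic) * @lebesgue_measure R
  (`](-e)%R, e[%classic))%E.
  exact: product_measure1E.
by rewrite !lebesgue_measure_itv/= lte_fin gtrN// -EFinB opprK -EFinM.
Qed.

Lemma sqr_coord_le_sqnorm (z : Cn) j :
  complex.Re (z 0 j) ^+ 2 <= sqnorm z /\ complex.Im (z 0 j) ^+ 2 <= sqnorm z.
Proof.
rewrite /sqnorm sum_normc (bigD1 j)//=.
have H : 0 <= \sum_(i < n | i != j)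
    (complex.Re (z 0 i) ^+ 2 + complex.Im (z 0 i) ^+ 2).
  by apply: sumr_ge0 => i _; rewrite addr_ge0// sqr_ge0.
by split; rewrite -addrA ?lerDl 1?addrCA ?lerDl addr_ge0// sqr_ge0.
Qed.

Lemma measurable_box (e : R) : measurable
  [set z : Cn | forall j, -e < complex.Re (z 0 j) < e /\ -e < complex.Im (z 0
    j) < e].
Proof.
rewrite (_ : mkset _ = \bigcap_(j in [set: 'I_n])
    (((fun z : Cn => complex.Re (z 0 j)) @^-1` `]-e, e[) `&`
     ((fun z : Cn => complex.Im (z 0 j)) @^-1` `]-e, e[))).
  apply: fin_bigcap_measurable => // j _; apply: measurableI;
  rewrite -[X in measurable X]setTI.
    exact: measurable_Re_coord.
  exact: measurable_Im_coord.
apply/seteqP; split=> z /= H j; have := H j; rewrite /= !in_itv/= => H'.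
  by move=> _; have [] := H' .
by have [] := H' I.
Qed.

(** Together with [volume_uball_lty] this makes [bergman_cst] a genuine inverse: [fine] sends +oo to
    0, and the inverse of 0 is 0. *)
Lemma volume_uball_gt0 : (0 < vol (@uball R n))%E.
Proof.
(* The open box of half-side [e] lies in the ball because 2 n e^2 < 1. *)
pose e : R := (2 * n.+1%:R)^-1.
have e0 : 0 < e by rewrite invr_gt0 mulr_gt0.
apply: (@lt_le_trans _ _ (((e *+ 2) ^+ 2) ^+ n)%:E).
  by rewrite lte_fin !exprn_gt0// pmulrn_lgt0.
rewrite -volume_box//; apply: le_measure; rewrite ?inE.
- exact: measurable_box.
- exact: measurable_uball.
move=> z /= H; rewrite uballE /sqnorm sum_normc.
apply: (@le_lt_trans _ _ (\sum_(j < n) (e ^+ 2 *+ 2))).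
  apply: ler_sum => j _; have [/andP[h1 h2] /andP[h3 h4]] := H j.
  by rewrite mulr2n lerD// -real_normK ?num_real// lerXn2r ?nnegrE//
    ?ltW// ltr_norml ?h1 ?h3.
rewrite sumr_const card_ord -mulrnA -mulr_natr.
have em : 2 * e * n%:R = 1 - 2 * e.
  have : 2 * n.+1%:R * e = 1 by rewrite mulfV// mulf_neq0.
  by rewrite -natr1; lra.
have -> : e ^+ 2 * (2 * n)%:R = e * (2 * e * n%:R) by rewrite natrM; ring.
have h : 0 <= 1 - 2 * e by rewrite -em !mulr_ge0// ltW.
rewrite em mulrBr mulr1 mulrCA -expr2.
by have := sqr_ge0 e; move: h; lra.
Qed.

Lemma volume_uball_lty : (vol (@uball R n) < +oo)%E.
Proof.
apply: (@le_lt_trans _ _ (((1 *+ 2) ^+ 2) ^+ n : R)%:E); last exact: ltry.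
rewrite -volume_box//; apply: le_measure; rewrite ?inE.
- exact: measurable_uball.
- exact: measurable_box.
move=> z; rewrite uballE => z1 j /=.
have [h1 h2] := sqr_coord_le_sqnorm z j.
have L (x : R) : x ^+ 2 <= sqnorm z -> -1 < x < 1.
  move=> xz; rewrite -ltr_norml -(@expr_lt1 R 2 `|x|) ?normr_ge0//.
  by rewrite real_normK ?num_real// (le_lt_trans xz).
by split; exact: L.
Qed.

End volume_theory.
(** * Goursat's theorem on rectangles *)

Section goursat.
Variable R : realType.
Local Notation leb := (@lebesgue_measure R).
Implicit Types (f g : R -> R) (P Q : R -> R -> R).

Definition itv_integral f (a b : R) : R := (\int[leb]_(x in `[a, b]) f x)%R.
Local Notation itv_integrable f a b :=
  (leb.-integrable `[a, b]%classic (EFin \o f)).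

Lemma itv_integrable_cts f a b :
  (forall x, a <= x <= b -> {for x, continuous f}) -> itv_integrable f a b.
Proof.
move=> cf; apply: continuous_compact_integrable; first exact: segment_compact.
by apply: continuous_in_subspaceT => x; rewrite inE/= in_itv/=; exact: cf.
Qed.

Lemma itv_integral_split f a m b : a <= m -> m <= b -> itv_integrable f a b ->
  itv_integral f a b = itv_integral f a m + itv_integral f m b.
Proof.
move=> am mb intf; apply/eqP; rewrite addrC -subr_eq; apply/eqP.
rewrite /itv_integral Rintegral_itvB ?bnd_simp//.
rewrite Rintegral_itv_obnd_cbnd//; apply: integrableS intf => //.
by apply: subset_itvr; rewrite bnd_simp.
Qed.

(** Serves twice: for opposite sides of a rectangle, where the integrands differ by nearly a
    constant, and with [g] = 0 for the integral over a small circle, where the integrand is nearly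
    its value at the centre. *)
Lemma itv_integral_approx f g a b k e : a <= b ->
  itv_integrable f a b -> itv_integrable g a b ->
  (forall x, a <= x <= b -> `|f x - g x - k| <= e) ->
  `|itv_integral f a b - itv_integral g a b - k * (b - a)| <= e * (b - a).
Proof.
move=> ab intf intg fgk.
have vol_ab : fine (leb `[a, b]%classic) = b - a.
  rewrite lebesgue_measure_itv/= lte_fin; move: ab; rewrite le_eqVlt.
  by case/predU1P => [->|->]; rewrite ?ltxx ?subrr// -EFinB.
have intc r : itv_integrable (fun=> r) a b.
  by apply: itv_integrable_cts => x _; exact: cvg_cst.
have intfg : itv_integrable (fun x => f x - g x) a b.
  exact: (integrableB _ intf intg).
have intfgk : itv_integrable (fun x => f x - g x - k) a b.
  exact: (integrableB _ intfg (intc k)).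
rewrite /itv_integral -RintegralB// -vol_ab -[k * _]Rintegral_cst//.
rewrite -[e * _]Rintegral_cst// -RintegralB//.
apply: le_trans.
  by apply: le_normr_Rintegral.
apply: le_Rintegral => //=; first exact: integrable_norm intfgk.
Qed.

(* P dx + Q dy is differentiable at (x, y), with dP/dy = dQ/dx = l. *)
Definition form_diff P Q x y := exists p l q, forall e, 0 < e ->
  exists2 del, 0 < del & forall x' y', `|x' - x| < del -> `|y' - y| < del ->
    `|P x' y' - P x y - (p * (x' - x) + l * (y' - y))| <=
      e * (`|x' - x| + `|y' - y|) /\
    `|Q x' y' - Q x y - (l * (x' - x) + q * (y' - y))| <=
      e * (`|x' - x| + `|y' - y|).

(* The integral of P dx + Q dy along the counterclockwise boundary of
   [a, b] x [c, d]. *)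
Definition bd_integral P Q a b c d : R :=
  (itv_integral (Q b) c d - itv_integral (Q a) c d) -
  (itv_integral (P ^~ d) a b - itv_integral (P ^~ c) a b).

(** This makes the four side integrals exist. The bound with e = 1 gives |h v - h u| <= (1 + |k|) |v
    - u| near u, which is enough. *)
Lemma form_diff_cts P Q x y : form_diff P Q x y ->
  {for x, continuous (P ^~ y)} /\ {for y, continuous (Q x)}.
Proof.
move=> [p [l [q H]]].
have cts (h : R -> R) u k : (exists2 del, 0 < del & forall v, `|v - u| < del ->
    `|h v - h u - k * (v - u)| <= `|v - u|) -> {for u, continuous h}.
  move=> [del del0 hk]; apply/cvgrPdist_le => /= e e0.
  have k1 : 0 < 1 + `|k| by rewrite ltr_pwDl.
  near=> v.
  have uv : `|v - u| < del.
    by rewrite distrC; near: v; apply/nbhs_ballP; exists del.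
  have uv' : `|v - u| < e / (1 + `|k|).
    rewrite distrC; near: v; apply/nbhs_ballP.
    by exists (e / (1 + `|k|)) => //=; rewrite divr_gt0.
  rewrite distrC -[h v - h u](subrK (k * (v - u))).
  rewrite (le_trans (ler_normD _ _))// normrM.
  apply: (@le_trans _ _ ((1 + `|k|) * `|v - u|)).
    by rewrite mulrDl mul1r lerD2r hk.
  by rewrite mulrC -ler_pdivlMr// ltW.
have [del del0 hd] := H 1 ltr01.
split.
  apply: (cts (P ^~ y) x p); exists del => // v vx.
  have := hd v y vx; rewrite !subrr normr0 => /(_ del0)[+ _].
  by rewrite mulr0 !addr0 mul1r.
apply: (cts (Q x) y q); exists del => // v vy.
have := hd x v; rewrite !subrr normr0 => /(_ del0 vy)[_].
by rewrite mulr0 !add0r mul1r.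
Unshelve. all: by end_near. Qed.

(** The interior sides are traversed twice, in opposite directions, and cancel. *)
Lemma bd_integral_split P Q a b c d :
  a <= b -> c <= d ->
  (forall x y, a <= x <= b -> c <= y <= d -> form_diff P Q x y) ->
  let m := (a + b) / 2 in let n := (c + d) / 2 in
  bd_integral P Q a b c d =
  bd_integral P Q a m c n + bd_integral P Q m b c n +
  bd_integral P Q a m n d + bd_integral P Q m b n d.
Proof.
move=> ab cd dPQ m n.
have [am mb] : a <= m /\ m <= b by rewrite /m; lra.
have [cn nd] : c <= n /\ n <= d by rewrite /n; lra.
have intP y : c <= y <= d -> itv_integrable (P ^~ y) a b.
  by move=> yd; apply: itv_integrable_cts => x /dPQ/(_ yd)/form_diff_cts[].
have intQ x : a <= x <= b -> itv_integrable (Q x) c d.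
  by move=> xd; apply: itv_integrable_cts => y /(dPQ _ _ xd)/form_diff_cts[].
have spP y : c <= y <= d -> itv_integral (P ^~ y) a b =
    itv_integral (P ^~ y) a m + itv_integral (P ^~ y) m b.
  by move=> yd; apply: itv_integral_split => //; exact: intP.
have spQ x : a <= x <= b -> itv_integral (Q x) c d =
    itv_integral (Q x) c n + itv_integral (Q x) n d.
  by move=> yd; apply: itv_integral_split => //; exact: intQ.
rewrite /bd_integral (spP d) ?(spP c) ?(spQ a) ?(spQ b) ?lexx ?ab ?cd//.
by lra.
Qed.

(** The affine part of the form has the same cross coefficient [l] in [P] and in [Q], so both pairs
    of sides contribute l (b - a) (d - c) and the two contributions cancel. Only the remainder is
    left, at most 2 e times the half-perimeter along each pair of sides. *)
Lemma bd_integral_small P Q a b c d x0 y0 p l q e :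
  a <= b -> c <= d -> a <= x0 <= b -> c <= y0 <= d -> 0 <= e ->
  (forall x y, a <= x <= b -> c <= y <= d -> form_diff P Q x y) ->
  (forall x y, a <= x <= b -> c <= y <= d ->
    `|P x y - P x0 y0 - (p * (x - x0) + l * (y - y0))| <=
      e * (`|x - x0| + `|y - y0|) /\
    `|Q x y - Q x0 y0 - (l * (x - x0) + q * (y - y0))| <=
      e * (`|x - x0| + `|y - y0|)) ->
  `|bd_integral P Q a b c d| <= 2 * e * (b - a + (d - c)) ^+ 2.
Proof.
move=> ab cd /andP[ax xb] /andP[cy yd] e0 dPQ H.
have intP y : c <= y <= d -> itv_integrable (P ^~ y) a b.
  by move=> yd'; apply: itv_integrable_cts => x /dPQ/(_ yd')/form_diff_cts[].
have intQ x : a <= x <= b -> itv_integrable (Q x) c d.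
  by move=> xd; apply: itv_integrable_cts => y /(dPQ _ _ xd)/form_diff_cts[].
have eL x y : a <= x <= b -> c <= y <= d ->
    e * (`|x - x0| + `|y - y0|) <= e * (b - a + (d - c)).
  move=> /andP[? ?] /andP[? ?]; apply: ler_wpM2l => //.
  by apply: lerD; rewrite ler_norml; lra.
have HQ : `|itv_integral (Q b) c d - itv_integral (Q a) c d - l * (b - a) * (d
  - c)|
    <= 2 * e * (b - a + (d - c)) * (d - c).
  apply: itv_integral_approx => // [||y yd'].
  - by apply: intQ; rewrite lexx ab.
  - by apply: intQ; rewrite lexx ab.
  have bb : a <= b <= b by rewrite lexx ab.
  have aa : a <= a <= b by rewrite lexx ab.
  have [_ hb] := H b y bb yd'; have [_ ha] := H a y aa yd'.
  have := le_trans hb (eL _ _ bb yd'); have := le_trans ha (eL _ _ aa yd').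
  by rewrite !ler_norml; lra.
have HP : `|itv_integral (P ^~ d) a b - itv_integral (P ^~ c) a b - l * (d - c)
  * (b - a)|
    <= 2 * e * (b - a + (d - c)) * (b - a).
  apply: itv_integral_approx => // [||x xd'].
  - by apply: intP; rewrite lexx cd.
  - by apply: intP; rewrite lexx cd.
  have dd : c <= d <= d by rewrite lexx cd.
  have cc : c <= c <= d by rewrite lexx cd.
  have [hb _] := H x d xd' dd; have [ha _] := H x c xd' cc.
  have := le_trans hb (eL _ _ xd' dd); have := le_trans ha (eL _ _ xd' cc).
  by rewrite !ler_norml; lra.
move: HQ HP; rewrite /bd_integral.
have -> : 2 * e * (b - a + (d - c)) ^+ 2 =
  2 * e * (b - a + (d - c)) * (d - c) + 2 * e * (b - a + (d - c)) * (b - a) by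
    ring.
rewrite (_ : l * (d - c) * (b - a) = l * (b - a) * (d - c)); last by ring.
by rewrite !ler_norml; lra.
Qed.

Lemma itv_dist (a b x y : R) : a <= x <= b -> a <= y <= b -> `|x - y| <= b - a.
Proof. by move=> /andP[? ?] /andP[? ?]; rewrite ler_norml; lra. Qed.

(* Goursat's bisection: of the four quarters of a rectangle one carries at least
   a quarter of the boundary integral. *)
Theorem bd_integral_eq0 P Q a b c d :
  a <= b -> c <= d ->
  (forall x y, a <= x <= b -> c <= y <= d -> form_diff P Q x y) ->
  bd_integral P Q a b c d = 0.
Proof.
move=> ab cd dPQ.
pose B (r : R * R * (R * R)) := bd_integral P Q r.1.1 r.1.2 r.2.1 r.2.2.
pose inside (r : R * R * (R * R)) :=
  [/\ a <= r.1.1, r.1.1 <= r.1.2, r.1.2 <= b & [/\ c <= r.2.1,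
    r.2.1 <= r.2.2 & r.2.2 <= d]].
pose quarter (r r' : R * R * (R * R)) :=
  [/\ [/\ r.1.1 <= r'.1.1, r'.1.2 <= r.1.2, r.2.1 <= r'.2.1 & r'.2.2 <= r.2.2],
    r'.1.2 - r'.1.1 = (r.1.2 - r.1.1) / 2, r'.2.2 - r'.2.1 =
      (r.2.2 - r.2.1) / 2 &
    `|B r| <= 4 * `|B r'|].
have quarterP r : inside r -> exists r', quarter r r'.
  case: r => -[a1 b1] [c1 d1] [/= aa1 ab1 bb1 [cc1 cd1 dd1]].
  pose m := (a1 + b1) / 2; pose n := (c1 + d1) / 2.
  have := @bd_integral_split P Q a1 b1 c1 d1 ab1 cd1.
  have dPQ1 x y : a1 <= x <= b1 -> c1 <= y <= d1 -> form_diff P Q x y.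
    by move=> /andP[? ?] /andP[? ?]; apply: dPQ; apply/andP; split; lra.
  move=> /(_ dPQ1)/=; rewrite -/m -/n => E.
  have [am mb ma bm] : [/\ a1 <= m, m <= b1, m - a1 =
    (b1 - a1) / 2 & b1 - m = (b1 - a1) / 2].
    by clear -ab1; split; rewrite /m; lra.
  have [cn nd nc dn] : [/\ c1 <= n, n <= d1, n - c1 =
    (d1 - c1) / 2 & d1 - n = (d1 - c1) / 2].
    by clear -cd1; split; rewrite /n; lra.
  pose r1 := ((a1, m), (c1, n)); pose r2 := ((m, b1), (c1, n)).
  pose r3 := ((a1, m), (n, d1)); pose r4 := ((m, b1), (n, d1)).
  have [h1|h1] := leP `|B ((a1, b1), (c1, d1))| (4 * `|B r1|).
    by exists r1.
  have [h2|h2] := leP `|B ((a1, b1), (c1, d1))| (4 * `|B r2|).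
    by exists r2.
  have [h3|h3] := leP `|B ((a1, b1), (c1, d1))| (4 * `|B r3|).
    by exists r3.
  exists r4; split=> //=.
  have : `|B (a1, b1, (c1, d1))| <= `|B r1| + `|B r2| + `|B r3| + `|B r4|.
    rewrite {1}/B/= E (le_trans (ler_normD _ _))// lerD2r.
    by rewrite (le_trans (ler_normD _ _))// lerD2r ler_normD.
  move: (`|B r1|) (`|B r2|) (`|B r3|) (`|B r4|) (`|B _|) h1 h2 h3.
  by clear => *; lra.
pose next r := xget ((a, b), (c, d)) [set r' | quarter r r'].
have nextP r : inside r -> quarter r (next r).
  by move=> /quarterP; exact: (@xgetPex _ _ [set r' | quarter r r']).
pose r_ k := iter k next ((a, b), (c, d)).
have inside_next r : inside r -> inside (next r).
  move=> ir; have := nextP r ir; case: ir => ? ? ? [? ? ?].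
  case=> -[aa bb cc dd] lx ly _; split; try split;
  by rewrite ?(le_trans _ aa) ?(le_trans bb) ?(le_trans _ cc) ?(le_trans dd)//
    -subr_ge0 ?lx ?ly divr_ge0// subr_ge0.
have inside_r k : inside (r_ k).
  by elim: k => [|k IH]; [split; rewrite ?lexx|exact: inside_next].
have r_S k : quarter (r_ k) (r_ k.+1) by apply: nextP; exact: inside_r.
have mono j k : (r_ j).1.1 <= (r_ (k + j)%N).1.1 /\ (r_ (k + j)%N).1.2 <=
  (r_ j).1.2 /\
    (r_ j).2.1 <= (r_ (k + j)%N).2.1 /\ (r_ (k + j)%N).2.2 <= (r_ j).2.2.
  elim: k => [|k [h1 [h2 [h3 h4]]]]; first by rewrite add0n !lexx.
  have [[? ? ? ?] _ _ _] := r_S (k + j)%N; rewrite addSn.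
  by do !split; [exact: le_trans h1 _|exact: le_trans h2|exact: le_trans h3
    _|exact: le_trans h4].
have cross j k : (r_ j).1.1 <= (r_ k).1.2 /\ (r_ j).2.1 <= (r_ k).2.2.
  have [h1 [_ [h3 _]]] := mono j k; have [_ [h2 [_ h4]]] := mono k j.
  have [_ h5 _ [_ h6 _]] := inside_r (k + j)%N.
  by split; [apply: le_trans h1 (le_trans h5 _)|apply: le_trans h3 (le_trans h6
    _)];
    rewrite addnC.
(* By [cross] every left end lies below every right end, and likewise for lower and upper ends, so
   these suprema give a point common to all the rectangles. *)
pose x0 := sup (range (fun k => (r_ k).1.1)).
pose y0 := sup (range (fun k => (r_ k).2.1)).
have x0P k : (r_ k).1.1 <= x0 <= (r_ k).1.2.
  apply/andP; split.
    apply: ub_le_sup; last by exists k.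
    by exists (r_ 0%N).1.2 => _ [j _ <-]; have [] := cross j 0%N.
  apply: ge_sup; first by exists (r_ 0%N).1.1; exists 0%N.
  by move=> _ [j _ <-]; have [] := cross j k.
have y0P k : (r_ k).2.1 <= y0 <= (r_ k).2.2.
  apply/andP; split.
    apply: ub_le_sup; last by exists k.
    by exists (r_ 0%N).2.2 => _ [j _ <-]; have [] := cross j 0%N.
  apply: ge_sup; first by exists (r_ 0%N).2.1; exists 0%N.
  by move=> _ [j _ <-]; have [] := cross j k.
pose L := b - a + (d - c).
have L0 : 0 <= L by rewrite /L; lra.
have lenE k : (r_ k).1.2 - (r_ k).1.1 + ((r_ k).2.2 - (r_ k).2.1) = L / 2 ^+ k.
  elim: k => [|k IH]; first by rewrite expr0 divr1.
  have [_ -> -> _] := r_S k; rewrite -mulrDl IH exprS.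
  by rewrite invfM mulrA mulrAC.
have BE k : `|B (r_ 0%N)| <= 4 ^+ k * `|B (r_ k)|.
  elim: k => [|k IH]; first by rewrite expr0 mul1r.
  have [_ _ _ h] := r_S k; rewrite (le_trans IH)// exprSr -mulrA.
  by apply: ler_wpM2l => //; exact: exprn_ge0.
have [p [l [q H]]] := dPQ _ _ (x0P 0%N) (y0P 0%N).
rewrite -[LHS]/(B (r_ 0%N)); apply/eqP; rewrite -normr_le0;
  apply/ler_addgt0Pl => e e0; rewrite addr0.
(* The k-th rectangle has half-perimeter L / 2^k, so the factor 4^k is absorbed and the final bound
   2 e' L^2 is at most [e]. Adding 1 keeps the denominator nonzero when L = 0. *)
pose e' := e / (2 * (L ^+ 2 + 1)).
have e'0 : 0 < e' by rewrite divr_gt0// mulr_gt0// ltr_wpDl// sqr_ge0.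
have [del del0 Hd] := H e' e'0.
have [k Lk] : exists k, L / 2 ^+ k < del.
  exists (Num.bound (L / del)); rewrite ltr_pdivrMr ?exprn_gt0// mulrC
    -ltr_pdivrMr//.
  apply: (lt_trans (archi_boundP _)); first by rewrite divr_ge0// ltW.
  by rewrite -natrX ltr_nat ltn_expl.
have [aa1 ab1 bb1 [cc1 cd1 dd1]] := inside_r k.
apply: (le_trans (BE k)).
apply: (@le_trans _ _ (4 ^+ k * (2 * e' * (L / 2 ^+ k) ^+ 2))).
  rewrite ler_wpM2l ?exprn_ge0// -lenE.
  apply: (@bd_integral_small _ _ _ _ _ _ x0 y0 p l q) => //.
  - exact: ltW.
  - move=> x y /andP[h1 h2] /andP[h3 h4]; apply: dPQ.
      by rewrite (le_trans aa1 h1) (le_trans h2 bb1).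
    by rewrite (le_trans cc1 h3) (le_trans h4 dd1).
  move: Lk; rewrite -lenE => Lk x y xab ycd; apply: Hd; apply: le_lt_trans Lk.
    by rewrite (le_trans (itv_dist xab (x0P k)))// lerDl subr_ge0.
  by rewrite (le_trans (itv_dist ycd (y0P k)))// lerDr subr_ge0.
rewrite expr_div_n -exprM mulnC exprM (_ : 2 ^+ 2 = 4); last by ring.
have -> : 4 ^+ k * (2 * e' * (L ^+ 2 / 4 ^+ k)) = 2 * e' * L ^+ 2.
  by field; rewrite expf_neq0.
have -> : 2 * e' * L ^+ 2 = e * (L ^+ 2 / (L ^+ 2 + 1)).
  by rewrite /e'; field; rewrite gt_eqF// ltr_wpDl// sqr_ge0.
rewrite ler_piMr ?(ltW e0)// ler_pdivrMr ?ltr_wpDl ?sqr_ge0// mul1r.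
by rewrite lerDl.
Qed.

End goursat.
(** * Circle means of holomorphic functions *)

Lemma differentiable_approx (K : numFieldType) (V W : normedModType K)
    (f : V -> W) (x : V) : differentiable f x ->
  forall e, 0 < e -> exists2 del : K, 0 < del &
    forall h, `|h| < del -> `|f (h + x) - f x - 'd f x h| <= e * `|h|.
Proof.
move=> /diff_locally fx e e0.
have /eqaddoP := fx.
move=> /(_ e e0)/nbhs_ballP[del /= del0 H]; exists del => // h hd.
have := H h; rewrite -ball_normE /= sub0r normrN => /(_ hd).
by rewrite -[X in `|X|]/(f (h + x) - (f x + 'd f x h)) opprD addrA.
Qed.

Section complex_norm.
Variable R : realType.
Local Notation C := R[i].
Local Notation normc := (@Normc.normc R).
Implicit Types z w : C.

Lemma normE z : `|z| = (normc z)%:C%C.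
Proof. by case: z. Qed.

Lemma normc_ge0 z : 0 <= normc z.
Proof. by case: z => a b; exact: sqrtr_ge0. Qed.

Lemma sqr_normcE z : normc z ^+ 2 = complex.Re z ^+ 2 + complex.Im z ^+ 2.
Proof. by case: z => a b /=; rewrite sqr_sqrtr// addr_ge0 ?sqr_ge0. Qed.

Lemma normr_Re_le z : `|complex.Re z| <= normc z.
Proof.
by case: z => a b /=; rewrite -sqrtr_sqr ler_wsqrtr// lerDl sqr_ge0.
Qed.

Lemma normr_Im_le z : `|complex.Im z| <= normc z.
Proof.
by case: z => a b /=; rewrite -sqrtr_sqr ler_wsqrtr// lerDr sqr_ge0.
Qed.

Lemma normc_le_ReIm z : normc z <= `|complex.Re z| + `|complex.Im z|.
Proof.
case: z => a b /=; rewrite -[leRHS]ger0_norm ?addr_ge0// -sqrtr_sqr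
  ler_wsqrtr//.
by rewrite sqrrD !real_normK ?num_real// addrAC lerDl mulrn_wge0.
Qed.

Lemma normcD_le z w : normc (z + w) <= normc z + normc w.
Proof. exact: le_normcD. Qed.

End complex_norm.

Section polar.
Variable R : realType.
Local Notation C := R[i].
Local Notation normc := (@Normc.normc R).

Definition cexp (s t : R) : C := (expR s * cos t +i* (expR s * sin t))%C.

Lemma cexpD s t h k : cexp (s + h) (t + k) = cexp s t * cexp h k.
Proof.
apply/eqP; rewrite eq_complex/= expRD cosD sinD; apply/andP; split; apply/eqP;
by ring.
Qed.

Lemma normc_cexp s t : normc (cexp s t) = expR s.
Proof.
rewrite /= !exprMn -mulrDr cos2Dsin2 mulr1 sqrtr_sqr gtr0_norm//.
exact: expR_gt0.
Qed.

Lemma is_derive_approx (f : R -> R) (x l : R) : is_derive x 1 f l ->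
  forall e, 0 < e -> exists2 del, 0 < del &
    forall h, `|h| < del -> `|f (h + x) - f x - l * h| <= e * `|h|.
Proof.
move=> fl e e0; have df : differentiable f x.
  by apply/derivable1_diffP; exact: ex_derive.
have [del del0 H] := differentiable_approx df e0; exists del => // h /H.
rewrite diff1E// derive1E (@derive_val _ _ _ _ _ _ _ fl).
by rewrite -[_ *: _]/(_ * _) mulrC.
Qed.

Lemma cexp_approx e : 0 < e -> exists2 del, 0 < del &
  forall h k, `|h| < del -> `|k| < del ->
    normc (cexp h k - 1 - (h +i* k)%C) <= e * (`|h| + `|k|).
Proof.
(* The real part costs u |h| + 2 u |k| and the imaginary part u |h| + 3 u |k|, together at most 5 u
   (|h| + |k|). Below, |h| < 1 bounds |1 + h| by 2, and |h| < u controls the product h k. *)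
move=> e0; pose u := e / 5; have u0 : 0 < u by rewrite divr_gt0.
have [d1 d10 H1] := is_derive_approx (is_derive_expR 0) u0.
have [d2 d20 H2] := is_derive_approx (is_derive_cos 0) u0.
have [d3 d30 H3] := is_derive_approx (is_derive_sin 0) u0.
pose del := Num.min (Num.min d1 d2) (Num.min d3 (Num.min u 1)).
exists del; first by rewrite !lt_min d10 d20 d30 u0 ltr01.
move=> h k; rewrite !lt_min => /andP[/andP[hd1 _] /andP[_ /andP[hu h1]]].
move=> /andP[/andP[_ kd2] /andP[kd3 /andP[_ _]]].
have := H1 h hd1; rewrite addr0 expR0 mul1r => {}H1.
have := H2 k kd2; rewrite addr0 cos0 sin0 oppr0 mul0r subr0 => {}H2.
have := H3 k kd3; rewrite addr0 cos0 sin0 mul1r subr0 => {}H3.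
apply: (le_trans (normc_le_ReIm _)) => /=.
have sk : `|sin k| <= 1 by rewrite ler_norml sin_geN1 sin_le1.
have ck : `|cos k| <= 1 by rewrite ler_norml cos_geN1 cos_le1.
have h2 : `|1 + h| <= 2.
  by rewrite (le_trans (ler_normD _ _))// normr1; lra.
have hRe : `|expR h * cos k - 1 - h| <= u * `|h| + 2 * (u * `|k|).
  have -> : expR h * cos k - 1 - h = (expR h - 1 - h) * cos k + (1 + h) * (cos
    k - 1).
    by ring.
  rewrite (le_trans (ler_normD _ _))// !normrM; apply: lerD.
    by rewrite -[leRHS]mulr1 ler_pM.
  by rewrite ler_pM.
have hIm : `|expR h * sin k - 0 - k| <= u * `|h| + 2 * (u * `|k|) + u * `|k|.
  have -> : expR h * sin k - 0 - k =
      (expR h - 1 - h) * sin k + (1 + h) * (sin k - k) + h * k.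
    by ring.
  rewrite (le_trans (ler_normD _ _))// normrM; apply: lerD; last first.
    by rewrite ler_wpM2r// ltW.
  rewrite (le_trans (ler_normD _ _))// !normrM; apply: lerD.
    by rewrite -[leRHS]mulr1 ler_pM.
  by rewrite ler_pM.
apply: (le_trans (lerD hRe hIm)).
have -> : e = 5 * u by rewrite /u; field.
have := mulr_ge0 (ltW u0) (normr_ge0 h); have := mulr_ge0 (ltW u0) (normr_ge0
  k).
by rewrite mulrDr -!mulrA; move: (u * `|h|) (u * `|k|) => *; lra.
Qed.

End polar.
Section circle_mean.
Variable R : realType.
Local Notation C := R[i].
Local Notation leb := (@lebesgue_measure R).
Local Notation normc := (@Normc.normc R).
Implicit Type g : C -> C.

(** Stated with the real-valued modulus [normc], so that all estimates take place in [R]; the norm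
    of the normed module [C] is complex-valued. *)
Definition cderivable g (z : C) := exists alpha : C, forall e, 0 < e ->
  exists2 del, 0 < del & forall h, normc h < del ->
    normc (g (h + z) - g z - alpha * h) <= e * normc h.

(* In the coordinates (s, t), z = exp (s + i t), complex differentiability of g
   says that the form (Im g) ds + (Re g) dt is closed. *)
Lemma cderivable_form_diff g s t : s <= 0 -> cderivable g (cexp s t) ->
  form_diff (fun s t => complex.Im (g (cexp s t)))
            (fun s t => complex.Re (g (cexp s t))) s t.
Proof.
move=> s0 [alpha H].
(* By the chain rule [beta] is the derivative of g(exp zeta) at zeta = s + i t. Its s-derivative is
   beta and its t-derivative i beta, whence the coefficients p = Im beta, l = Re beta and q = - Im
   beta: these are the Cauchy-Riemann equations. *)
pose beta := alpha * cexp s t.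
exists (complex.Im beta), (complex.Re beta), (- complex.Im beta) => e e0.
pose a := normc alpha; have a0 : 0 <= a by exact: normc_ge0.
have a1 : 0 < 2 * (a + 1) by rewrite mulr_gt0// ltr_wpDl.
have [d1 d10 H1] := H (e / 4) (divr_gt0 e0 (ltr0n _ 4)).
(* The error of exp, multiplied by a = |alpha|, must stay below e/2, and the bound 1 gives |exp (h +
   i k) - 1| <= 2 N. The error of [g] takes the other half: e/4 times an increment of size at most 2
   N. *)
pose e2 := Num.min 1 (e / (2 * (a + 1))).
have e20 : 0 < e2 by rewrite lt_min ltr01 divr_gt0.
have e21 : e2 <= 1 by rewrite ge_min lexx.
have ae2 : a * e2 <= e / 2.
  apply: (@le_trans _ _ (a * (e / (2 * (a + 1))))).
    by rewrite ler_wpM2l// ge_min lexx orbT.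
  have -> : a * (e / (2 * (a + 1))) = (e / 2) * (a / (a + 1)).
    by field; rewrite gt_eqF// ltr_wpDl.
  by rewrite ler_piMr ?divr_ge0 ?(ltW e0)// ler_pdivrMr ?ltr_wpDl// mul1r lerDl.
have [d2 d20 H2] := cexp_approx e20.
(* With |h| and |k| below d1 / 4 the increment of exp, at most 2 (|h| + |k|), is less than d1. *)
exists (Num.min d2 (d1 / 4)); first by rewrite lt_min d20 divr_gt0.
move=> s' t'; rewrite !lt_min => /andP[sd2 sd1] /andP[td2 td1].
set h := s' - s in sd1 sd2 *; set k := t' - t in td1 td2 *.
pose N := `|h| + `|k|; have N0 : 0 <= N by rewrite addr_ge0.
have {}H2 := H2 h k sd2 td2.
have E' : cexp s' t' = cexp s t * cexp h k by rewrite -cexpD /h /k !subrKC.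
have E1 : normc (cexp s t) <= 1 by rewrite normc_cexp expR_le1.
have Ehk : normc (cexp h k - 1) <= 2 * N.
  have -> : cexp h k - 1 = (cexp h k - 1 - (h +i* k)%C) + (h +i* k)%C by
    rewrite subrK.
  rewrite (le_trans (normcD_le _ _))// mulrDl mul1r; apply: lerD.
    by rewrite (le_trans H2)// ler_piMl.
  exact: normc_le_ReIm.
have EE : normc (cexp s' t' - cexp s t) <= 2 * N.
  rewrite E' -[X in _ - X]mulr1 -mulrBr Normc.normcM -[leRHS]mul1r.
  by rewrite ler_pM// normc_ge0.
have EEd : normc (cexp s' t' - cexp s t) < d1.
  by rewrite (le_lt_trans EE)// /N; clear -sd1 td1; lra.
have {}H1 := H1 _ EEd; rewrite subrK in H1.
have key : normc (g (cexp s' t') - g (cexp s t) - beta * (h +i* k)%C) <= e * N.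
  have -> : g (cexp s' t') - g (cexp s t) - beta * (h +i* k)%C =
      (g (cexp s' t') - g (cexp s t) - alpha * (cexp s' t' - cexp s t)) +
      alpha * (cexp s t * (cexp h k - 1 - (h +i* k)%C)).
    by rewrite E' /beta; ring.
  rewrite (le_trans (normcD_le _ _))//.
  have -> : e * N = e / 4 * (2 * N) + e / 2 * N by field.
  apply: lerD; first by rewrite (le_trans H1)// ler_wpM2l// divr_ge0// ltW.
  rewrite !Normc.normcM -/a; apply: (@le_trans _ _ (a * (1 * (e2 * N)))).
    by rewrite ler_wpM2l// ler_pM// normc_ge0.
  by rewrite mul1r mulrA ler_wpM2r.
have ReIm (u v w : C) : complex.Re (u - v - w) =
  complex.Re u - complex.Re v - complex.Re w
    /\ complex.Im (u - v - w) = complex.Im u - complex.Im v - complex.Im w.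
  by case: u => ? ?; case: v => ? ?; case: w => ? ?.
have [ERe EIm] := ReIm (g (cexp s' t')) (g (cexp s t)) (beta * (h +i* k)%C).
have MReIm (b : C) (x y : R) :
    complex.Re (b * (x +i* y)%C) = complex.Re b * x + - complex.Im b * y /\
    complex.Im (b * (x +i* y)%C) = complex.Im b * x + complex.Re b * y.
  by case: b => b1 b2; split=> /=; ring.
have [MRe MIm] := MReIm beta h k.
split.
  by apply: le_trans key; apply: le_trans (normr_Im_le _); rewrite EIm MIm.
by apply: le_trans key; apply: le_trans (normr_Re_le _); rewrite ERe MRe.
Qed.

Lemma cderivable_cts g z : cderivable g z -> forall e, 0 < e ->
  exists2 del, 0 < del & forall w, normc (w - z) < del ->
    normc (g w - g z) <= e.
Proof.
move=> [alpha H] e e0; have [d d0 {}H] := H 1 ltr01.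
pose a := normc alpha; have a0 : 0 <= a by exact: normc_ge0.
have a1 : 0 < 1 + a by rewrite ltr_pwDl.
exists (Num.min d (e / (1 + a))); first by rewrite lt_min d0 divr_gt0.
move=> w; rewrite lt_min => /andP[wd we]; have := H _ wd;
  rewrite subrK mul1r => {}H.
rewrite -[g w - g z](subrK (alpha * (w - z))) (le_trans (normcD_le _ _))//.
rewrite Normc.normcM -/a; apply: (@le_trans _ _ ((1 + a) * normc (w - z))).
  by rewrite mulrDl mul1r lerD2r.
by rewrite mulrC -ler_pdivlMr// ltW.
Qed.

(** The sides t = 0 and t = 2 pi cancel by periodicity, so Goursat's theorem equates the integrals
    over the circles of radius 1 and e^s. Continuity of [g] at 0 evaluates the latter up to an
    arbitrarily small error. *)
Theorem circle_mean_Re g :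
  (forall z, normc z <= 1 -> cderivable g z) ->
  itv_integral (fun t => complex.Re (g (cexp 0 t))) 0 (pi *+ 2) =
  complex.Re (g 0) * (pi *+ 2).
Proof.
move=> dg; have pi20 : 0 <= pi *+ 2 :> R by rewrite mulrn_wge0// pi_ge0.
have fd s t : s <= 0 -> form_diff (fun s t => complex.Im (g (cexp s t)))
            (fun s t => complex.Re (g (cexp s t))) s t.
  by move=> s0; apply: cderivable_form_diff => //; apply: dg;
    rewrite normc_cexp expR_le1.
have const s : s <= 0 ->
    itv_integral (fun t => complex.Re (g (cexp 0 t))) 0 (pi *+ 2) =
    itv_integral (fun t => complex.Re (g (cexp s t))) 0 (pi *+ 2).
  move=> s0.
  have := @bd_integral_eq0 _ (fun s t => complex.Im (g (cexp s t)))
    (fun s t => complex.Re (g (cexp s t))) s 0 0 (pi *+ 2) s0 pi20.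
  have fd' x y : s <= x <= 0 -> 0 <= y <= pi *+ 2 ->
    form_diff (fun s t => complex.Im (g (cexp s t))) (fun s t =>
      complex.Re (g (cexp s t))) x y.
    by move=> /andP[_ x0] _; exact: fd.
  move=> /(_ fd'); rewrite /bd_integral.
  have -> : (fun x => complex.Im (g (cexp x (pi *+ 2)))) = (fun x =>
    complex.Im (g (cexp x 0))).
    by apply/funext => x; rewrite /cexp cos2pi sin2pi cos0 sin0.
  by rewrite subrr subr0 => /eqP; rewrite subr_eq0 => /eqP.
apply/eqP; rewrite -subr_eq0 -normr_le0; apply/ler_addgt0Pl => e e0;
  rewrite addr0.
pose e' := e / (pi *+ 2 + 1).
have e'0 : 0 < e' by rewrite divr_gt0// ltr_wpDl.
have [|d d0 Hd] := @cderivable_cts g 0 _ e' e'0.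
  by apply: dg; rewrite Normc.normc0.
pose s := Num.min 0 (ln (d / 2)).
have s0 : s <= 0 by rewrite ge_min lexx.
have sd : expR s < d.
  apply: (@le_lt_trans _ _ (d / 2)); last by clear -d0; lra.
  by rewrite -[leRHS]lnK ?posrE ?divr_gt0// ler_expR ge_min lexx orbT.
rewrite (const s s0).
have pts : 0 <= (0 : R) <= pi *+ 2 by rewrite lexx.
have intg : leb.-integrable `[0, pi *+ 2]%classic
    (EFin \o (fun t => complex.Re (g (cexp s t)))).
  by apply: itv_integrable_cts => t _; have [] := form_diff_cts (fd s t s0).
have int0 : leb.-integrable `[0, pi *+ 2]%classic (EFin \o (fun=> 0 : R)).
  by apply: itv_integrable_cts => t _; exact: cvg_cst.
have := itv_integral_approx (k := complex.Re (g 0)) (e := e') pi20 intg int0.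
rewrite [itv_integral (fun=> 0) _ _](_ : _ = 0); last first.
  by rewrite /itv_integral Rintegral_cst// mul0r.
rewrite !subr0 => /(_ _)/le_trans; apply.
  move=> t _; rewrite subr0.
  have := Hd (cexp s t); rewrite subr0 normc_cexp => /(_ sd); apply: le_trans.
  apply: le_trans (normr_Re_le _).
  by case: (g _) => ? ?; case: (g _) => ? ?.
rewrite /e' mulrAC ler_pdivrMr ?ltr_wpDl// ler_wpM2l ?(ltW e0)// lerDl//.
Qed.

End circle_mean.
(** * The mean value property on the ball *)

Section mean_value.
Variables (R : realType) (n : nat).
Local Notation C := R[i].
Local Notation Cn := 'rV[C]_n.
Local Notation normc := (@Normc.normc R).
Local Notation RR := (measurableTypeR R).
Local Notation vol := (volume R n).
Local Notation leb := (@lebesgue_measure R).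

(** Required for Fubini's theorem on the product of the circle parameter and [vol]; it is
    transported from tuples along [realify]. *)
Lemma sigma_finite_volume : sigma_finite setT vol.
Proof.
have [F UF Foo] := sigma_finiteT (tuple_measure (@plane_measure R) n).
exists (fun k => @realify R n @^-1` F k).
  by rewrite -preimage_bigcup -UF preimage_setT.
move=> k; have [mF Fk] := Foo k; split.
  by rewrite -[X in measurable X]setTI; exact: measurable_realify.
rewrite volumeE (_ : _ @^-1` _ = F k)//.
by apply/seteqP; split=> t /=; rewrite complexifyK.
Qed.

HB.instance Definition _ := Measure_isSigmaFinite.Build _ _ _ vol
  sigma_finite_volume.

Lemma measurable_fun_Cn d (T : measurableType d) (h : T -> Cn) :
  (forall j, measurable_fun setT (fun x => complex.Re (h x 0 j))) ->
  (forall j, measurable_fun setT (fun x => complex.Im (h x 0 j))) ->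
  measurable_fun setT h.
Proof.
move=> hRe hIm; have mh : measurable_fun setT (@realify R n \o h).
  apply/measurable_fun_tnthP => j.
  rewrite (_ : _ \o _ = fun x => (complex.Re (h x 0 j) : RR,
    complex.Im (h x 0 j) : RR)).
    by apply: measurable_fun_pair; [exact: hRe|exact: hIm].
  by apply/funext => x /=; rewrite tnth_mktuple.
by move=> _ _ [B mB <-]; rewrite setTI -comp_preimage; exact: mh.
Qed.

Lemma measurable_scale_Cn d (T : measurableType d) (a b : T -> R) (h : T ->
  Cn) :
  measurable_fun setT a -> measurable_fun setT b -> measurable_fun setT h ->
  measurable_fun setT (fun x => (a x +i* b x)%C *: h x).
Proof.
move=> ma mb mh.
have hRe j : measurable_fun setT (fun x => complex.Re (h x 0 j)).
  exact: (measurableT_comp (measurable_Re_coord j) mh).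
have hIm j : measurable_fun setT (fun x => complex.Im (h x 0 j)).
  exact: (measurableT_comp (measurable_Im_coord j) mh).
apply: measurable_fun_Cn => j.
  rewrite (_ : (fun _ => _) = fun x => a x * complex.Re (h x 0 j) - b x *
    complex.Im (h x 0 j)).
    by apply: measurable_funB; apply: measurable_funM.
  by apply/funext => x; rewrite mxE; case: (h x 0 j).
rewrite (_ : (fun _ => _) = fun x => a x * complex.Im (h x 0 j) + b x *
  complex.Re (h x 0 j)).
  by apply: measurable_funD; apply: measurable_funM.
by apply/funext => x; rewrite mxE; case: (h x 0 j).
Qed.

Lemma measurable_rotation (t : R) : measurable_fun setT (fun z : Cn =>
  cexp 0 t *: z).
Proof. by apply: measurable_scale_Cn => //; exact: measurable_id. Qed.

Lemma cexp_circle (t : R) :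
  (expR 0 * cos t) ^+ 2 + (expR 0 * sin t) ^+ 2 = 1 :> R.
Proof. by rewrite expR0 !mul1r cos2Dsin2. Qed.

Local Open Scope ereal_scope.

Lemma ge0_integral_rotation (t : R) (u : Cn -> \bar R) :
  measurable_fun setT u -> (forall z, 0 <= u z) ->
  \int[vol]_z u (cexp 0 t *: z) = \int[vol]_z u z.
Proof.
move=> mu u0.
have := @ge0_integral_pushforward _ _ _ _ _ _ (measurable_rotation t) vol setT u
  measurableT mu (fun _ _ => u0 _).
rewrite preimage_setT => <-.
apply: eq_measure_integral => [|? A mA _]; first exact: measurable_rotation.
exact: volume_rotation (cexp_circle t) mA.
Qed.

Lemma integral_rotation (t : R) (u : Cn -> R) : measurable_fun setT u ->
  \int[vol]_z (u (cexp 0 t *: z))%:E = \int[vol]_z (u z)%:E.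
Proof.
move=> mu; have {}mu : measurable_fun setT (EFin \o u) by
  exact/measurable_EFinP.
rewrite integralE [RHS]integralE; congr (_ - _).
  have H := @ge0_integral_rotation t (EFin \o u)^\+ (measurable_funepos mu)
    (fun=> funepos_ge0 _ _).
  by rewrite -H; apply: eq_integral => z _; rewrite !funeposE.
have H := @ge0_integral_rotation t (EFin \o u)^\- (measurable_funeneg mu)
  (fun=> funeneg_ge0 _ _).
by rewrite -H; apply: eq_integral => z _; rewrite !funenegE.
Qed.

Lemma measurable_polar : measurable_fun setT
  (fun tz : RR * Cn => cexp 0 tz.1 *: tz.2).
Proof.
apply: measurable_scale_Cn => //; apply: measurable_funM => //.
  by apply: measurableT_comp => //; apply: continuous_measurable_fun;
    exact: continuous_cos.
by apply: measurableT_comp => //; apply: continuous_measurable_fun;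
  exact: continuous_sin.
Qed.

(** The function u(e^{it} z) is integrated over [0, 2 pi] x [C^n] in both orders. With z innermost,
    rotation invariance gives 2 pi times the integral of u; with t innermost, one gets 2 pi m on the
    ball and 0 off it, the ball being stable under rotation. *)
Lemma integral_circle_mean (u : Cn -> R) (m : R) :
  measurable_fun setT u -> vol.-integrable setT (EFin \o u) ->
  (forall z, uball z ->
     \int[leb]_(t in `[0%R, (pi *+ 2)%R]) (u (cexp 0 t *: z))%:E =
       (m * (pi *+ 2))%:E) ->
  (forall z, ~ uball z -> u z = 0%R) ->
  \int[vol]_z (u z)%:E = m%:E * vol (@uball R n).
Proof.
move=> mu iu circ u0.
pose D : set RR := `[0%R, (pi *+ 2)%R]%classic.
pose F (tz : RR * Cn) := (u (cexp 0 tz.1 *: tz.2) * \1_D tz.1)%:E.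
have mD : measurable D by exact: measurable_itv.
have mF : measurable_fun setT F.
  apply/measurable_EFinP; apply: measurable_funM.
    exact: (measurableT_comp mu measurable_polar).
  have m1 : measurable_fun setT (\1_D : RR -> R) by exact: measurable_indic.
  exact: (measurableT_comp m1 measurable_fst).
have lebD : leb D = (pi *+ 2)%:E.
  rewrite lebesgue_measure_itv/= lte_fin pmulrn_lgt0// pi_gt0.
  by rewrite oppr0 adde0.
have mui : measurable_fun setT (EFin \o u) by exact/measurable_EFinP.
have FD t z : F (t, z) = ((fun t => (u (cexp 0 t *: z))%:E) \_ D) t.
  rewrite /F patchE indicE/=; case: ifPn => _ /=; first by rewrite mulr1.
  by rewrite mulr0.
(* By Tonelli: for each t in [D] the integral of |F| over z is that of |u|, so the total is 2 pi
   times a finite number. *)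
have iF : (leb \x vol).-integrable setT F.
  apply/integrable12ltyP => //.
  have Kfin : \int[vol]_z `|(u z)%:E| \is a fin_num.
    by rewrite ge0_fin_numE ?integral_ge0//; move/integrableP : iu => [].
  rewrite (_ : \int[_]_x _ = \int[leb]_(t in D) (\int[vol]_z `|(u z)%:E|));
    last first.
    rewrite [RHS]integral_mkcond; apply: eq_integral => t _.
    rewrite [RHS]patchE; case: ifPn => tD.
      have H := @ge0_integral_rotation t (fun z => `|(u z)%:E|)
        (ltac:(exact: measurableT_comp)) (fun=> abse_ge0 _).
      by rewrite -H; apply: eq_integral => z _; rewrite FD patchE tD.
    by apply: integral0_eq => z _; rewrite FD patchE (negbTE tD) abse0.
  by rewrite -(fineK Kfin) integral_cst//= -[leb _]/(leb D) lebD -EFinM ltry.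
have pi2 : (pi *+ 2 != 0 :> R)%R by rewrite gt_eqF// pmulrn_lgt0// pi_gt0.
have iu_fin : \int[vol]_z (u z)%:E \is a fin_num by exact: integrable_fin_num.
have FubF := Fubini iF.
have L : \int[leb]_x \int[vol]_y F (x, y) = \int[vol]_z (u z)%:E * (pi *+ 2)%:E.
  transitivity (\int[leb]_(x in D) (\int[vol]_z (u z)%:E)).
    rewrite [RHS]integral_mkcond; apply: eq_integral => t _.
    rewrite [RHS]patchE; case: ifPn => tD.
      rewrite -[RHS](integral_rotation t)//; apply: eq_integral => z _.
      by rewrite FD patchE tD.
    by apply: integral0_eq => z _; rewrite FD patchE (negbTE tD).
  by rewrite -(fineK iu_fin) integral_cst//= -[leb _]/(leb D) lebD.
have Rt : \int[vol]_y \int[leb]_x F (x, y) = (m * (pi *+ 2))%:E * vol (@uball R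
  n).
  rewrite -integral_cst; last exact: measurable_uball.
  rewrite [RHS]integral_mkcond; apply: eq_integral => z _.
  transitivity (\int[leb]_(t in D) (u (cexp 0 t *: z))%:E).
    by rewrite [RHS]integral_mkcond; apply: eq_integral => t _; exact: FD.
  rewrite patchE; case: ifPn => zB; first by apply: circ; exact: set_mem.
  apply: integral0_eq => t _; rewrite u0// uballE sqnormZ normc_cexp expR0.
  by rewrite expr1n mul1r => zB'; move/negP: zB; apply; apply/mem_set.
have Vfin : vol (@uball R n) \is a fin_num.
  by rewrite ge0_fin_numE// volume_uball_lty.
move: FubF; rewrite L Rt -(fineK iu_fin) -(fineK Vfin) -!EFinM => -[E].
by congr EFin; apply: (mulIf pi2); rewrite E mulrAC.
Qed.

End mean_value.
Section bergman_mean_value.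
Variables (R : realType) (n : nat).
Local Notation C := R[i].
Local Notation Cn := 'rV[C]_n.
Local Notation normc := (@Normc.normc R).
Local Notation vol := (volume R n).
Local Notation leb := (@lebesgue_measure R).
Local Notation B := (@uball R n).

Lemma uballZ (a : C) (z : Cn) : normc a <= 1 -> B z -> B (a *: z).
Proof.
rewrite !uballE => a1 z1; rewrite sqnormZ; apply: le_lt_trans z1.
by rewrite ler_piMl ?sqnorm_ge0// expr_le1// normc_ge0.
Qed.

(** The slope is the differential of [f] applied to [z], which is linear over [C]. Dividing by N + 1
    rather than N = |z| includes the case z = 0. *)
Lemma cderivable_slice (f : Cn -> C) (z : Cn) (a : C) :
  differentiable f (a *: z) -> cderivable (fun b => f (b *: z)) a.
Proof.
move=> df; exists ('d f (a *: z) z) => e e0.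
pose N := complex.Re `|z|.
have NE : `|z| = N%:C%C by rewrite /N RRe_real// normr_real.
have N0 : 0 <= N by rewrite -ler0c -NE.
have N1 : 0 < N + 1 by rewrite ltr_wpDl.
have e'0 : 0 < (e / (N + 1))%:C%C :> C by rewrite ltcR divr_gt0.
have [del del0 H] := differentiable_approx df e'0.
have delE : del = (complex.Re del)%:C%C by rewrite RRe_real// gtr0_real.
exists (complex.Re del / (N + 1)).
  by rewrite divr_gt0// -ltcR -delE.
move=> h hd.
have hz : `|h *: z| = (normc h * N)%:C%C by rewrite normrZ NE normE -rmorphM.
have : `|h *: z| < del.
  rewrite hz delE ltcR; apply: (@le_lt_trans _ _ (normc h * (N + 1))).
    by rewrite ler_wpM2l ?normc_ge0// lerDl.
  by rewrite -ltr_pdivlMr.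
move=> /H; rewrite -scalerDl hz linearZ/= normE -rmorphM lecR.
rewrite [X in normc X](_ : _ = f ((h + a) *: z) - f (a *: z) - 'd f (a *: z) z
  * h).
  move=> /le_trans; apply.
  have -> : e / (N + 1) * (normc h * N) = e * normc h * (N / (N + 1)).
    by field; rewrite gt_eqF.
  rewrite ler_piMr ?mulr_ge0 ?normc_ge0 ?(ltW e0)// ler_pdivrMr// mul1r.
  by rewrite lerDl.
by rewrite [_ * h]mulrC.
Qed.

Lemma cderivableM (b : C) (g : C -> C) a : cderivable g a ->
  cderivable (fun z => b * g z) a.
Proof.
move=> [al H]; exists (b * al) => e e0.
have b1 : 0 < normc b + 1 by rewrite ltr_wpDl// normc_ge0.
have [|del del0 {}H] := H (e / (normc b + 1)); first by rewrite divr_gt0.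
exists del => // h /H {}H.
rewrite -mulrA -!mulrBr Normc.normcM.
apply: (@le_trans _ _ (normc b * (e / (normc b + 1) * normc h))).
  by rewrite ler_wpM2l// normc_ge0.
have -> : normc b * (e / (normc b + 1) * normc h) =
    e * normc h * (normc b / (normc b + 1)) by field; rewrite gt_eqF.
rewrite ler_piMr ?mulr_ge0 ?normc_ge0 ?(ltW e0)// ler_pdivrMr// mul1r.
by rewrite lerDl.
Qed.

(** The imaginary part of [g] is the real part of - i g, so the result for real parts serves
    twice. *)
Lemma circle_mean_ext (g : C -> C) :
  (forall z, normc z <= 1 -> cderivable g z) ->
  (\int[leb]_(t in `[0%R, (pi *+ 2)%R]) (complex.Re (g (cexp 0 t)))%:E =
    (complex.Re (g 0) * (pi *+ 2))%:E /\
  \int[leb]_(t in `[0%R, (pi *+ 2)%R]) (complex.Im (g (cexp 0 t)))%:E =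
    (complex.Im (g 0) * (pi *+ 2))%:E)%E.
Proof.
have Re_ext (h : C -> C) : (forall z, normc z <= 1 -> cderivable h z) ->
    (\int[leb]_(t in `[0%R, (pi *+ 2)%R]) (complex.Re (h (cexp 0 t)))%:E =
    (complex.Re (h 0) * (pi *+ 2))%:E)%E.
  move=> dh; rewrite -circle_mean_Re// /itv_integral /Rintegral fineK//.
  apply: integrable_fin_num => //; apply: itv_integrable_cts => t _.
  have fd : form_diff (fun s t => complex.Im (h (cexp s t)))
      (fun s t => complex.Re (h (cexp s t))) 0 t.
    by apply: cderivable_form_diff => //; apply: dh; rewrite normc_cexp expR0.
  by have [] := form_diff_cts fd.
move=> dg; split; first exact: Re_ext.
have ImE z : complex.Im z = complex.Re (- 'i%C * z) :> R.
  by case: z => a b /=; rewrite oppr0 mul0r mulN1r opprK add0r.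
have := @Re_ext (fun z => - 'i%C * g z) (fun z z1 => cderivableM _ (dg z z1)).
by rewrite -ImE => <-; apply: eq_integral => t _; rewrite ImE.
Qed.

(** Membership in [A2] gives measurability on the ball only; vanishing off the ball extends it to
    all of [C^n], where the rotations act. *)
Lemma A2_measurable (f : Cn -> C) : A2 f ->
  measurable_fun setT (fun z => complex.Re (f z)) /\ measurable_fun setT (fun z
    => complex.Im (f z)).
Proof.
move=> [_ [mRe mIm _] f0].
split.
  rewrite (_ : (fun _ => _) = (fun z => complex.Re (f z)) \_ B).
    by apply/(measurable_restrict _ _ _).1 => //;
      [exact: measurable_uball|rewrite setTI].
  apply/funext => z; rewrite patchE; case: ifPn => // /negP zB.
  by rewrite /= f0// => /mem_set.
rewrite (_ : (fun _ => _) = (fun z => complex.Im (f z)) \_ B).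
  by apply/(measurable_restrict _ _ _).1 => //;
    [exact: measurable_uball|rewrite setTI].
apply/funext => z; rewrite patchE; case: ifPn => // /negP zB.
by rewrite /= f0// => /mem_set.
Qed.

Lemma A2_sqr_measurable (f : Cn -> C) : A2 f ->
  measurable_fun setT (fun z => normc (f z) ^+ 2).
Proof.
move=> /A2_measurable[mRe mIm].
under eq_fun do rewrite sqr_normcE.
by apply: measurable_funD; exact: measurable_funX.
Qed.

(* |h| <= |f|^2 + 1 replaces the Cauchy-Schwarz inequality. *)
Lemma A2_integral_le (f : Cn -> C) (h : Cn -> R) : A2 f ->
  measurable_fun setT h -> (forall z, `|h z| <= normc (f z)) ->
  (\int[vol]_(z in B) `|h z|%:E <=
   \int[vol]_(z in B) (normc (f z) ^+ 2)%:E + vol B)%E.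
Proof.
move=> fA2 mh hf; have mf := A2_sqr_measurable fA2.
have mB := @measurable_uball R n.
rewrite -[vol B]mul1e -(@integral_cst _ _ _ vol _ mB) -ge0_integralD//;
  first last.
- by apply/measurable_EFinP; exact: measurable_funTS.
- by move=> z _; rewrite lee_fin sqr_ge0.
apply: ge0_le_integral => //.
- by apply/measurable_EFinP; apply: measurableT_comp => //;
  exact: measurable_funTS.
- by apply/measurable_EFinP; apply: measurable_funD => //;
  exact: measurable_funTS.
move=> z _; rewrite -EFinD lee_fin; apply: le_trans (hf z) _.
have := normc_ge0 (f z); move: (normc _) => x x0.
by have := sqr_ge0 (x - 1); rewrite sqrrB; nra.
Qed.

Lemma A2_integrable (f : Cn -> C) : A2 f ->
  vol.-integrable setT (EFin \o (fun z => complex.Re (f z))) /\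
  vol.-integrable setT (EFin \o (fun z => complex.Im (f z))).
Proof.
move=> fA2; have [mRe mIm] := A2_measurable fA2; case: (fA2) => _ [_ _ sq] f0.
have dom (h : Cn -> R) : measurable_fun setT h ->
    (forall z, `|h z| <= normc (f z)) -> vol.-integrable setT (EFin \o h).
  move=> mh hf; apply/integrableP; split; first exact/measurable_EFinP.
  apply: le_lt_trans (_ : (\int[vol]_(z in B) (normc (f z) ^+ 2)%:E + vol B <
    +oo)%E).
    rewrite (le_trans _ (A2_integral_le fA2 mh hf))// le_eqVlt; apply/orP; left.
    rewrite [X in _ == X]integral_mkcond; apply/eqP/eq_integral => z _ /=.
    rewrite patchE; case: ifPn => // /negP zB.
    have := hf z; rewrite f0 ?Normc.normc0 ?normr_le0; last by move=> /mem_set.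
    by move=> /eqP ->; rewrite normr0.
  by rewrite lte_add_pinfty// volume_uball_lty.
split; apply: dom => // z; [exact: normr_Re_le|exact: normr_Im_le].
Qed.

(** For z in the ball and |b| <= 1 the point b z stays in the ball, so the slice b |-> f(b z) has
    circle mean f(0), the same constant for every z. *)
Lemma A2_mean_value (f : Cn -> C) : A2 f ->
  (\int[vol]_(z in B) (complex.Re (f z))%:E = (complex.Re (f 0))%:E * vol B /\
   \int[vol]_(z in B) (complex.Im (f z))%:E = (complex.Im (f 0))%:E * vol B)%E.
Proof.
move=> fA2; have [mRe mIm] := A2_measurable fA2;
  have [iRe iIm] := A2_integrable fA2.
case: (fA2) => hol _ f0.
have circ z : B z -> forall a, normc a <= 1 -> cderivable (fun b =>
  f (b *: z)) a.
  by move=> Bz a a1; apply: cderivable_slice; apply: hol; exact: uballZ.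
have restr (h : C -> R) : h 0 = 0 ->
    (\int[vol]_(z in B) (h (f z))%:E = \int[vol]_z (h (f z))%:E)%E.
  move=> h0; rewrite integral_mkcond; apply: eq_integral => z _.
  by rewrite patchE; case: ifPn => // /negP zB; rewrite f0 ?h0// => /mem_set.
split; rewrite restr//.
  apply: (@integral_circle_mean _ _ (fun z => complex.Re (f z))) => // z Bz.
    by have [-> _] := circle_mean_ext (circ z Bz); rewrite scale0r.
  by rewrite /= f0.
apply: (@integral_circle_mean _ _ (fun z => complex.Im (f z))) => // z Bz.
  by have [_ ->] := circle_mean_ext (circ z Bz); rewrite scale0r.
by rewrite /= f0.
Qed.

End bergman_mean_value.
(** * Constants and normalized kernels as elements of the Bergman space *)

Section complex_measurable.
Context d (T : measurableType d) (R : realType) (D : set T).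
Local Notation C := R[i].
Implicit Types f g : T -> C.

Definition cmeasurable f :=
  measurable_fun D (fun x => complex.Re (f x)) /\
  measurable_fun D (fun x => complex.Im (f x)).

Lemma cmeasurable_cst (a : C) : cmeasurable (fun=> a).
Proof. by split; exact: measurable_cst. Qed.

Lemma cmeasurableD f g : cmeasurable f -> cmeasurable g ->
  cmeasurable (fun x => f x + g x).
Proof.
move=> [fR fI] [gR gI]; split.
  rewrite (_ : (fun _ => _) = fun x => complex.Re (f x) + complex.Re (g x)).
    exact: measurable_funD.
  by apply/funext => x; case: (f x); case: (g x).
rewrite (_ : (fun _ => _) = fun x => complex.Im (f x) + complex.Im (g x)).
  exact: measurable_funD.
by apply/funext => x; case: (f x); case: (g x).
Qed.

Lemma cmeasurableM f g : cmeasurable f -> cmeasurable g ->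
  cmeasurable (fun x => f x * g x).
Proof.
move=> [fR fI] [gR gI]; split.
  rewrite (_ : (fun _ => _) = fun x => complex.Re (f x) * complex.Re (g x) -
      complex.Im (f x) * complex.Im (g x)).
    by apply: measurable_funB; exact: measurable_funM.
  by apply/funext => x; case: (f x); case: (g x).
rewrite (_ : (fun _ => _) = fun x => complex.Re (f x) * complex.Im (g x) +
    complex.Im (f x) * complex.Re (g x)).
  by apply: measurable_funD; exact: measurable_funM.
by apply/funext => x; case: (f x); case: (g x).
Qed.

Lemma cmeasurableB f g : cmeasurable f -> cmeasurable g ->
  cmeasurable (fun x => f x - g x).
Proof.
move=> mf mg; rewrite (_ : (fun _ => _) = fun x => f x + (- 1) * g x).
  by apply: cmeasurableD => //; apply: cmeasurableM => //;
    exact: cmeasurable_cst.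
by apply/funext => x; rewrite mulN1r.
Qed.

Lemma cmeasurable_conj f : cmeasurable f -> cmeasurable (fun x => conjc (f x)).
Proof.
move=> [fR fI]; split.
  by rewrite (_ : (fun _ => _) = fun x => complex.Re (f x))//;
    apply/funext => x; case: (f x).
rewrite (_ : (fun _ => _) = fun x => - complex.Im (f x)).
  exact: measurable_funN.
by apply/funext => x; case: (f x).
Qed.

Lemma cmeasurableX f k : cmeasurable f -> cmeasurable (fun x => f x ^+ k).
Proof.
move=> mf; elim: k => [|k IH].
  by under eq_fun do rewrite expr0; exact: cmeasurable_cst.
by under eq_fun do rewrite exprS; exact: cmeasurableM.
Qed.

(** The inverse is conj f / |f|^2, also at the zeros of [f], where both sides are 0. The real
    reciprocal is measurable as the power with exponent -1. *)
Lemma cmeasurableV f : cmeasurable f -> cmeasurable (fun x => (f x)^-1).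
Proof.
move=> mf; have [fR fI] := mf.
pose N x := complex.Re (f x) ^+ 2 + complex.Im (f x) ^+ 2.
have N0 x : 0 <= N x by rewrite addr_ge0 ?sqr_ge0.
have mN : measurable_fun D (fun x => (N x)^-1).
  rewrite (_ : (fun _ => _) = (fun y => y `^ (-1)) \o N).
    apply: measurableT_comp; first exact: measurable_powR.
    by apply: measurable_funD; exact: measurable_funX.
  by apply/funext => x /=; rewrite powR_inv1.
rewrite (_ : (fun _ => _) = fun x => conjc (f x) * ((N x)^-1)%:C%C).
  apply: cmeasurableM; first exact: cmeasurable_conj.
  by split => //; exact: measurable_cst.
apply/funext => x; rewrite /N; case: (f x) => a b.
by apply/eqP; rewrite eq_complex/= !mulr0 subr0 add0r mulNr eqxx/=.
Qed.

Lemma cmeasurable_sum n (f : 'I_n -> T -> C) : (forall i, cmeasurable (f i)) ->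
  cmeasurable (fun x => \sum_i f i x).
Proof.
elim: n f => [|n IH] f mf.
  by under eq_fun do rewrite big_ord0; exact: cmeasurable_cst.
by under eq_fun do rewrite big_ord_recr/=; apply: cmeasurableD => //; exact: IH.
Qed.

End complex_measurable.

(** Meant for [extend0 g], which coincides with [g] near every point of the open ball. *)
Lemma differentiable_near_eq (K : numFieldType) (V W : normedModType K)
    (f g : V -> W) (x : V) :
  (\forall y \near x, f y = g y) -> differentiable f x -> differentiable g x.
Proof.
move=> fg /diff_locallyP[cf /eqaddoP fE].
have gE : g \o shift x = cst (g x) + 'd f x +o_ (0 : V) id.
  apply/eqaddoP => e e0; have := fE e e0.
  have fgx : f x = g x by exact: nbhs_singleton fg.
  apply: filter_app.
  have : \forall h \near (0 : V), f (h + x) = g (h + x).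
    move/nbhs_ballP : fg => [r r0 H]; apply/nbhs_ballP; exists r => // h.
    rewrite -ball_normE/= => h0; apply: H.
    by rewrite -ball_normE/= opprD addrCA subrr addr0 -sub0r.
  apply: filter_app; near=> h => E.
  by rewrite /= -[X in `|X| <= _]/(f (h + x) - (f x + 'd f x h)) E fgx.
apply/diff_locallyP.
have dgE : 'd g x = 'd f x :> (V -> W) by exact: diff_unique.
by rewrite dgE.
Unshelve. all: by end_near.
Qed.

Section bergman_space.
Variables (R : realType) (n : nat).
Local Notation C := R[i].
Local Notation Cn := 'rV[C]_n.
Local Notation normc := (@Normc.normc R).
Local Notation vol := (volume R n).
Local Notation B := (@uball R n).

Lemma normc_sum (I : finType) (f : I -> C) : normc (\sum_i f i) <=
  \sum_i normc (f i).
Proof.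
elim/big_rec2: _ => [|i x y _ xy]; first by rewrite Normc.normc0.
by rewrite (le_trans (normcD_le _ _))// lerD2l.
Qed.

Lemma normc_conj (a : C) : normc (conjc a) = normc a.
Proof. by case: a => x y /=; rewrite sqrrN. Qed.

Lemma normc_cdot (z w : Cn) : normc (cdot z w) <= (sqnorm z + sqnorm w) / 2.
Proof.
rewrite (le_trans (normc_sum _))// /sqnorm -big_split/= mulr_suml.
apply: ler_sum => j _; rewrite Normc.normcM normc_conj.
by have := sqr_ge0 (normc (z 0 j) - normc (w 0 j)); rewrite sqrrB; lra.
Qed.

Lemma cdot0 (z : Cn) : cdot z 0 = 0.
Proof. by rewrite /cdot big1// => j _; rewrite mxE conjc0 mulr0. Qed.

Lemma cdot0l (z : Cn) : cdot 0 z = 0.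
Proof. by rewrite /cdot big1// => j _; rewrite mxE mul0r. Qed.

Lemma uball0 : B 0.
Proof.
rewrite uballE /sqnorm big1// => j _; rewrite mxE Normc.normc0.
by rewrite expr0n.
Qed.

Lemma open_uball : open B.
Proof.
rewrite openE => z; rewrite uballE => z1.
(* Balls of ['rV] are for the sup norm. Moving a coordinate of modulus at most 1 by less than e <= 1
   raises its squared modulus by at most 2 e + e^2 <= 3 e, and n such increments must stay below 1 -
   |z|^2. *)
pose e : R := Num.min 1 ((1 - sqnorm z) / (3 * n.+1%:R)).
have n3 : 0 < 3 * n.+1%:R :> R by rewrite mulr_gt0.
have e0 : 0 < e by rewrite lt_min ltr01 divr_gt0// subr_gt0.
have e1 : e <= 1 by rewrite ge_min lexx.
have en : 3 * n.+1%:R * e <= 1 - sqnorm z.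
  by rewrite mulrC -ler_pdivlMr// ge_min lexx orbT.
apply/nbhs_ballP; exists e%:C%C; first by rewrite /= ltcR.
move=> w [_ /(_ 0) zw]; rewrite uballE.
have wj j : normc (w 0 j) ^+ 2 <= normc (z 0 j) ^+ 2 + 3 * e.
  have := zw j; rewrite -ball_normE/= normE ltcR => /ltW h.
  have zj1 : normc (z 0 j) <= 1.
    rewrite -(@expr_le1 _ 2) ?normc_ge0//; apply: le_trans (ltW z1).
    by rewrite /sqnorm (bigD1 j)//= lerDl sumr_ge0// => i _; exact: sqr_ge0.
  have : normc (w 0 j) <= normc (z 0 j) + e.
    rewrite (_ : w 0 j = z 0 j + - (z 0 j - w 0 j));
      last by rewrite opprB addrC subrK.
    by rewrite (le_trans (normcD_le _ _))// lerD2l normcN.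
  have := normc_ge0 (w 0 j); have := normc_ge0 (z 0 j).
  move: zj1; move: (normc (z 0 j)) (normc (w 0 j)) => a b a1 a0 b0 ba.
  apply: (@le_trans _ _ ((a + e) ^+ 2)); first by rewrite lerXn2r ?nnegrE
    ?addr_ge0 ?(ltW e0).
  rewrite sqrrD -addrA lerD2l.
  have : a * e <= e by rewrite ler_piMl// ltW.
  have : e ^+ 2 <= e by rewrite expr2 ler_piMl// ltW.
  by rewrite -mulr_natl; lra.
apply: (@le_lt_trans _ _ (sqnorm z + n%:R * (3 * e))).
  rewrite mulr_natl -[n in _ *+ n](card_ord n) -sumr_const /sqnorm -big_split/=.
  by apply: ler_sum => j _; exact: wj.
have : n%:R * (3 * e) < n.+1%:R * (3 * e) by rewrite ltr_pM2r ?mulr_gt0//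
  ltr_nat.
by move: en; rewrite mulrAC -mulrA mulrC; lra.
Qed.

(** A bounded function is square integrable because the ball has finite volume. *)
Lemma A2_extend0 (g : Cn -> C) (M : R) :
  (forall z, B z -> differentiable g z) -> cmeasurable setT g ->
  (forall z, B z -> normc (g z) <= M) -> A2 (extend0 g).
Proof.
move=> dg [mRe mIm] gM.
have extE z : B z -> extend0 g z = g z by move=> Bz; rewrite /extend0 mem_set.
have mB := @measurable_uball R n.
split; last first.
- by move=> z zB; rewrite /extend0; case: ifPn => // /set_mem.
- split.
  + apply: (eq_measurable_fun (fun z => complex.Re (g z))).
      by move=> z /set_mem Bz; rewrite extE.
    exact: measurable_funTS.
  + apply: (eq_measurable_fun (fun z => complex.Im (g z))).
      by move=> z /set_mem Bz; rewrite extE.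
    exact: measurable_funTS.
  + apply: (@le_lt_trans _ _ (\int[vol]_(z in B) (M ^+ 2)%:E)%E); last first.
      by rewrite integral_cst//= lte_mul_pinfty ?lee_fin ?sqr_ge0//
        volume_uball_lty.
    apply: ge0_le_integral => //.
    * by move=> z _; rewrite lee_fin sqr_ge0.
    * apply/measurable_EFinP.
      apply: (eq_measurable_fun (fun z => complex.Re (g z) ^+ 2 + complex.Im (g
        z) ^+ 2)).
        by move=> z /set_mem Bz; rewrite extE// sqr_normcE.
      by apply: measurable_funTS; apply: measurable_funD;
        exact: measurable_funX.
    * move=> z Bz; rewrite lee_fin extE// lerXn2r ?nnegrE ?normc_ge0 ?gM//.
      by rewrite (le_trans (normc_ge0 _) (gM z Bz)).
- move=> z Bz; apply: differentiable_near_eq (dg z Bz).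
  have := open_nbhs_nbhs (conj open_uball Bz).
  by apply: filterS => w Bw; rewrite extE.
Qed.

Lemma A2_cst (a : C) : A2 (extend0 (fun _ : Cn => a)).
Proof.
by apply: (@A2_extend0 _ (normc a)).
Qed.

Lemma cmeasurable_cdot (z : Cn) : cmeasurable setT (fun w => cdot w z).
Proof.
apply: cmeasurable_sum => j; apply: cmeasurableM; last exact: cmeasurable_cst.
by split; [exact: measurable_Re_coord|exact: measurable_Im_coord].
Qed.

Lemma cmeasurable_cdotr (z : Cn) : cmeasurable setT (fun w => cdot z w).
Proof.
apply: cmeasurable_sum => j; apply: cmeasurableM; first exact: cmeasurable_cst.
apply: cmeasurable_conj.
by split; [exact: measurable_Re_coord|exact: measurable_Im_coord].
Qed.

Lemma cmeasurable_bergmanr (z : Cn) : cmeasurable setT (fun w => bergman z w).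
Proof.
apply: cmeasurableM; first exact: cmeasurable_cst.
apply: cmeasurableV; apply: cmeasurableX; apply: cmeasurableB.
  exact: cmeasurable_cst.
exact: cmeasurable_cdotr.
Qed.

(** The lower bound is uniform in [w]: for fixed [z] in the ball it makes w |-> K(w, z) bounded,
    which puts the normalized kernel in [A2]. *)
Lemma normc_1Bcdot (w z : Cn) : B w -> (1 - sqnorm z) / 2 <=
  normc (1 - cdot w z).
Proof.
rewrite uballE => w1; have := normc_cdot w z.
have := normcD_le (1 - cdot w z) (cdot w z); rewrite subrK Normc.normc1.
by lra.
Qed.

Lemma A2_normalized_kernel (z : Cn) : B z -> A2 (normalized_kernel z).
Proof.
move=> Bz; have z1 : sqnorm z < 1 by [].
pose m := (1 - sqnorm z) / 2; have m0 : 0 < m by rewrite divr_gt0// subr_gt0.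
have nz w : B w -> 1 - cdot w z != 0.
  move=> Bw; apply/eqP => E; have := normc_1Bcdot z Bw; rewrite E Normc.normc0.
  by rewrite leNgt -/m m0.
apply: (@A2_extend0 _ (normc ((bergman_cst R n)%:C%C) * (m ^- n.+1) *
  normc ((Num.sqrt (bergman_diag z))%:C%C)^-1)).
- move=> w Bw.
  have dcdot : differentiable (fun w : Cn => 1 - cdot w z) w.
    apply: differentiableB; first exact: differentiable_cst.
    rewrite (_ : (fun w => cdot w z) = \sum_j (fun w : Cn =>
      w 0 j * conjc (z 0 j))).
      apply: differentiable_sum => j; apply: differentiableM.
        exact: differentiable_coord.
      exact: differentiable_cst.
    by apply/funext => v; rewrite fct_sumE.
  apply: differentiableM; last exact: differentiable_cst.
  apply: differentiableM; first exact: differentiable_cst.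
  apply: differentiableV; last by rewrite expf_neq0// nz.
  elim: n.+1 => [|k IH]; first by under eq_fun do rewrite expr0;
    exact: differentiable_cst.
  by under eq_fun do rewrite exprS; exact: differentiableM.
- apply: cmeasurableM; last exact: cmeasurable_cst.
  apply: cmeasurableM; first exact: cmeasurable_cst.
  apply: cmeasurableV; apply: cmeasurableX; apply: cmeasurableB.
    exact: cmeasurable_cst.
  exact: cmeasurable_cdot.
- move=> w Bw; rewrite !Normc.normcM ler_wpM2r ?normc_ge0//.
  rewrite ler_wpM2l ?normc_ge0// Normc.normcV.
  have normcX (a : C) k : normc (a ^+ k) = normc a ^+ k.
    by elim: k => [|k IH]; rewrite ?expr0 ?Normc.normc1// !exprS Normc.normcM
      IH.
  have h := normc_1Bcdot z Bw; rewrite normcX lef_pV2 ?posrE ?exprn_gt0//.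
    by rewrite lerXn2r// nnegrE ?normc_ge0// ltW.
  exact: lt_le_trans h.
Qed.

End bergman_space.
(** * Integrability of the Berezin transform *)

Section shells.
Variables (R : realType) (n : nat) (n_gt0 : (0 < n)%N).
Local Notation C := R[i].
Local Notation Cn := 'rV[C]_n.
Local Notation normc := (@Normc.normc R).
Local Notation vol := (volume R n).
Local Notation B := (@uball R n).
Local Notation lam := (@lambda R n).
Local Notation c := (bergman_cst R n).
Local Notation h := (2^-1 : R).
Local Notation V := (fine (vol B)).

Lemma fine_volumeE : (vol B = V%:E)%E.
Proof. by rewrite fineK// ge0_fin_numE// volume_uball_lty. Qed.

Lemma fine_volume_gt0 : 0 < V.
Proof. by rewrite -lte_fin -fine_volumeE volume_uball_gt0. Qed.

Lemma bergman_cst_gt0 : 0 < c.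
Proof. by rewrite invr_gt0 fine_volume_gt0. Qed.

Lemma bergman_diag_sqnorm (z : Cn) : bergman_diag z =
  c * (1 - sqnorm z) ^- n.+1.
Proof. by rewrite bergman_diagE -sum_normc. Qed.

Lemma bergmanz0 (z : Cn) : bergman z 0 = c%:C%C.
Proof. by rewrite /bergman cdot0 subr0 expr1n invr1 mulr1. Qed.

Lemma berezin_dirac0 (z : Cn) : B z ->
  berezin (\d_(0 : Cn)) z = (c * (1 - sqnorm z) ^+ n.+1)%:E.
Proof.
move=> Bz; have mB := @measurable_uball R n.
rewrite /berezin integral_dirac//=; last first.
  apply/measurable_EFinP; apply: (measurable_funS measurableT) => //.
  have [mRe mIm] := cmeasurable_bergmanr z.
  by under eq_fun do rewrite sqr_normcE; apply: measurable_funD;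
    exact: measurable_funX.
rewrite diracE mem_set ?mul1e; last exact: uball0.
rewrite bergmanz0 bergman_diag_sqnorm sqr_normcE/= expr0n/= addr0 -EFinM.
congr EFin; rewrite invfM (invrK (_ ^+ n.+1)); field.
by rewrite gt_eqF// bergman_cst_gt0.
Qed.

Definition shell k : set Cn := [set z | h ^+ k.+1 < 1 - sqnorm z <= h ^+ k].

Lemma exprh_gt0 k : 0 < h ^+ k.
Proof. by rewrite exprn_gt0// invr_gt0. Qed.

Lemma exprh_le1 k : h ^+ k <= 1.
Proof. by rewrite exprn_ile1// invf_le1// ler1n. Qed.

Lemma shellE k : shell k =
  [set z | sqnorm z < 1 - h ^+ k.+1] `\` [set z | sqnorm z < 1 - h ^+ k].
Proof.
apply/seteqP; split=> z /=.
  by move=> /andP[h1 h2]; split; [lra|apply/negP; rewrite -leNgt; lra].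
by move=> [h1 /negP]; rewrite -leNgt => h2; apply/andP; split; lra.
Qed.

Lemma measurable_shell k : measurable (shell k).
Proof. by rewrite shellE; apply: measurableD; exact: measurable_sqnorm_lt. Qed.

Lemma shell_uball k : shell k `<=` B.
Proof.
by move=> z /andP[h1 _]; rewrite uballE -subr_gt0; apply: lt_trans h1;
  exact: exprh_gt0.
Qed.

Lemma uball_shell : B = \bigcup_k shell k.
Proof.
apply/seteqP; split=> [z|z [k _]]; last exact: shell_uball.
rewrite uballE => z1; have rho0 : 0 < 1 - sqnorm z by rewrite subr_gt0.
have ex : exists k, h ^+ k.+1 < 1 - sqnorm z.
  exists (Num.bound (1 - sqnorm z)^-1).
  rewrite exprVn invf_plt ?posrE//.
  apply: (lt_trans (archi_boundP _)); first by rewrite invr_ge0 ltW.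
  rewrite -natrX ltr_nat expnS (leq_trans (ltn_expl _ (isT : 1 < 2)%N))//.
  by rewrite leq_pmull.
(* Minimality of k gives the other inequality rho <= h^k; for k = 0 it reads rho <= 1. *)
exists (ex_minn ex) => //; case: ex_minnP => k hk kmin; rewrite /shell/= hk/=.
case: k hk kmin => [|k] hk kmin.
  by rewrite expr0 lerBlDr lerDl sqnorm_ge0.
by rewrite leNgt; apply/negP => /kmin; rewrite ltnn.
Qed.

Lemma trivIset_shell : trivIset setT shell.
Proof.
apply: ltn_trivIset => j i ij; apply/seteqP; split=> // z [] /andP[h1 _]
  /andP[_ h2].
have : h ^+ j <= h ^+ i.+1.
  by rewrite ler_wiXn2l// ?invr_ge0// invf_le1// ler1n.
by move: h1 h2; lra.
Qed.

Lemma volume_sqnorm_lt_fine (t : R) : 0 <= t -> vol [set z | sqnorm z < t] =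
  (t ^+ n * V)%:E.
Proof.
rewrite le_eqVlt => /predU1P[<-|t0]; last first.
  by rewrite volume_sqnorm_lt// fine_volumeE -EFinM.
rewrite expr0n gtn_eqF// mul0r (_ : mkset _ = set0) ?measure0//.
by apply/seteqP; split=> // z /=; rewrite ltNge sqnorm_ge0.
Qed.

Lemma volume_shell k :
  vol (shell k) = (((1 - h ^+ k.+1) ^+ n - (1 - h ^+ k) ^+ n) * V)%:E.
Proof.
have hk : h ^+ k.+1 <= h ^+ k by rewrite exprS ler_piMl ?(ltW (exprh_gt0 _))//
  invf_le1 ?ler1n.
have volE m : vol [set z | sqnorm z < 1 - h ^+ m] = ((1 - h ^+ m) ^+ n * V)%:E.
  by rewrite volume_sqnorm_lt_fine// subr_ge0 exprh_le1.
pose A m : set Cn := [set z | sqnorm z < 1 - h ^+ m].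
have mA m : measurable (A m) by exact: measurable_sqnorm_lt.
rewrite shellE -/(A k.+1) -/(A k).
have Afin : (vol (A k.+1) < +oo)%E by rewrite volE ltry.
transitivity (vol (A k.+1) - vol (A k.+1 `&` A k))%E; first exact: measureD.
rewrite setIidr; last by move=> z /=; rewrite /A/=; lra.
by rewrite !volE -EFinB mulrBl.
Qed.

(** The quotient of x^m - y^m by x - y is a sum of m monomials in x and y, each at most 1. *)
Lemma exprB_le (x y : R) m : 0 <= y -> y <= x -> x <= 1 ->
  x ^+ m - y ^+ m <= m%:R * (x - y).
Proof.
move=> y0 yx x1; elim: m => [|m IH]; first by rewrite !expr0 subrr mul0r.
have -> : x ^+ m.+1 - y ^+ m.+1 = x * (x ^+ m - y ^+ m) + (x - y) * y ^+ m.
  by rewrite !exprS; ring.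
rewrite -natr1 [leRHS]mulrDl mul1r; apply: lerD.
  apply: le_trans IH; rewrite ler_piMl// subr_ge0 lerXn2r// nnegrE.
  exact: le_trans yx.
by rewrite ler_piMr ?subr_ge0// exprn_ile1// (le_trans yx).
Qed.

(** Only the leading monomial x^m of the quotient is kept; the others are nonnegative. *)
Lemma exprB_ge (x y : R) m : 0 <= y -> y <= x ->
  (x - y) * x ^+ m <= x ^+ m.+1 - y ^+ m.+1.
Proof.
move=> y0 yx; rewrite !exprS mulrBl lerD2l lerN2 ler_wpM2l// lerXn2r// nnegrE.
exact: le_trans yx.
Qed.

Lemma volume_shell_le k : (vol (shell k) <= (n%:R * h ^+ k.+1 * V)%:E)%E.
Proof.
rewrite volume_shell lee_fin ler_wpM2r ?(ltW fine_volume_gt0)//.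
have e : h ^+ k.+1 = (1 - h ^+ k.+1) - (1 - h ^+ k).
  by rewrite exprS; lra.
rewrite [in leRHS]e; apply: exprB_le.
- by rewrite subr_ge0 exprh_le1.
- by rewrite -subr_ge0 -e ltW// exprh_gt0.
- by rewrite gerBl ltW// exprh_gt0.
Qed.

(** The outer squared radius 1 - h^(k+1) is at least 1/2 for every k, which accounts for the factor
    [h ^+ n.-1]; the case k = 0, where the shell contains the origin, is included. *)
Lemma volume_shell_ge k : ((h ^+ k.+1 * h ^+ n.-1 * V)%:E <= vol (shell k))%E.
Proof.
rewrite volume_shell lee_fin ler_wpM2r ?(ltW fine_volume_gt0)//.
have e : h ^+ k.+1 = (1 - h ^+ k.+1) - (1 - h ^+ k).
  by rewrite exprS; lra.
have hx : h <= 1 - h ^+ k.+1.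
  by rewrite exprS; have := exprh_le1 k; lra.
rewrite -[in leRHS](prednK n_gt0) [X in X * _]e;
  apply: le_trans (exprB_ge _ _ _).
- apply: ler_wpM2l; first by rewrite -e ltW// exprh_gt0.
  by rewrite lerXn2r// nnegrE ?invr_ge0// (le_trans _ hx)// invr_ge0.
- by rewrite subr_ge0 exprh_le1.
- by rewrite -subr_ge0 -e ltW// exprh_gt0.
Qed.

End shells.

(** * Comparison with geometric series *)

Section series_comparison.
Variable R : realType.
Local Open Scope ereal_scope.

(** Applied to the shells with r = h^((n+1) p - n), and to the singular values with r = 0, where r^0
    = 1 keeps exactly the first term. *)
Lemma nneseries_geometric_lty (u : nat -> \bar R) (A r : R) :
  (0 <= A)%R -> (0 <= r)%R -> (r < 1)%R -> (forall k, 0 <= u k) ->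
  (forall k, u k <= (A * r ^+ k)%:E) -> \sum_(0 <= k <oo) u k < +oo.
Proof.
move=> A0 r0 r1 u0 uA; apply: (@le_lt_trans _ _ (A / (1 - r))%:E);
  last exact: ltry.
apply: lime_le; first exact: is_cvg_nneseries.
apply: nearW => N; apply: (@le_trans _ _ (A * (1 - r ^+ N) / (1 - r))%:E).
  elim: N => [|N IH]; first by rewrite big_geq// expr0 subrr mulr0 mul0r.
  rewrite big_nat_recr//=; apply: le_trans (leeD IH (uA N)) _.
  rewrite -EFinD lee_fin le_eqVlt; apply/orP; left; apply/eqP.
  by rewrite exprS; field; rewrite subr_eq0 gt_eqF.
rewrite lee_fin ler_wpM2r ?invr_ge0 ?subr_ge0 ?(ltW r1)// ler_piMr//.
by rewrite gerBl exprn_ge0.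
Qed.

(** All terms are at least [A], so the partial sums exceed any bound. The case r = 1 is the endpoint
    exponent. *)
Lemma nneseries_geometric_oo (u : nat -> \bar R) (A r : R) :
  (0 < A)%R -> (1 <= r)%R -> (forall k, (A * r ^+ k)%:E <= u k) ->
  \sum_(0 <= k <oo) u k = +oo.
Proof.
move=> A0 r1 uA; have Au k : A%:E <= u k.
  by apply: le_trans (uA k); rewrite lee_fin ler_peMr ?(ltW A0)// exprn_ege1.
have u0 k : 0 <= u k by apply: le_trans (Au k); rewrite lee_fin ltW.
apply/eqyP => M M0.
apply: le_trans (nneseries_lim_ge (Num.bound (M / A)) (fun k _ _ => u0 k)).
apply: (@le_trans _ _ (\sum_(0 <= k < Num.bound (M / A)) A%:E));
  last exact: lee_sum.
rewrite sumEFin lee_fin big_const_nat subn0 iter_addr_0 -[leRHS]mulr_natl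
  -ler_pdivrMr//.
by rewrite ltW// archi_boundP// divr_ge0// ltW.
Qed.

End series_comparison.

(** * The integral of the Berezin transform, shell by shell *)

Section berezin_integral.
Variables (R : realType) (n : nat) (n_gt0 : (0 < n)%N).
Local Notation Cn := 'rV[R[i]]_n.
Local Notation vol := (volume R n).
Local Notation B := (@uball R n).
Local Notation lam := (@lambda R n).
Local Notation c := (bergman_cst R n).
Local Notation h := (2^-1 : R).
Local Notation V := (fine (vol B)).
Local Notation shell := (@shell R n).

Lemma lambda_shell k :
  lam (shell k) = (\int[vol]_(z in shell k) (bergman_diag z)%:E)%E.
Proof. by rewrite /lambda setIidl//; exact: shell_uball. Qed.

Lemma measurable_bergman_diag_shell k :
  measurable_fun (shell k) (EFin \o @bergman_diag R n).
Proof.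
apply/measurable_EFinP.
apply: (measurable_funS (@measurable_uball R n)) (@measurable_bergman_diag R n).
exact: shell_uball.
Qed.

(** K(z, z) decreases as rho grows, so on the shell it is at most its value at rho = h^(k+1); the
    value at rho = h^k serves for the lower bound. *)
Lemma lambda_shell_le k : (lam (shell k) <=
  (c * (h ^+ k.+1) ^- n.+1 * (n%:R * h ^+ k.+1 * V))%:E)%E.
Proof.
have c0 := bergman_cst_gt0 R n; have mS := @measurable_shell R n k.
rewrite lambda_shell; apply: (@le_trans _ _
    (\int[vol]_(z in shell k) (c * (h ^+ k.+1) ^- n.+1)%:E)%E).
  apply: ge0_le_integral => //.
  - by move=> z /shell_uball; rewrite lee_fin; exact: bergman_diag_ge0.
  - exact: measurable_bergman_diag_shell.
  move=> z /andP[h1 _]; rewrite lee_fin bergman_diag_sqnorm ler_wpM2l ?(ltW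
    c0)//.
  rewrite lef_pV2 ?posrE ?exprn_gt0 ?(lt_trans _ h1) ?exprh_gt0//.
  by rewrite lerXn2r ?nnegrE ?(ltW h1)// ltW// ?(lt_trans _ h1)// exprh_gt0.
rewrite integral_cst// [leRHS]EFinM lee_wpmul2l//; last exact: volume_shell_le.
by rewrite lee_fin mulr_ge0 ?(ltW c0)// invr_ge0 exprn_ge0// ltW// exprh_gt0.
Qed.

Lemma lambda_shell_ge k :
  ((c * (h ^+ k) ^- n.+1 * (h ^+ k.+1 * h ^+ n.-1 * V))%:E <= lam (shell k))%E.
Proof.
have c0 := bergman_cst_gt0 R n; have mS := @measurable_shell R n k.
have C0 : 0 <= c * (h ^+ k) ^- n.+1.
  by rewrite mulr_ge0 ?(ltW c0)// invr_ge0 exprn_ge0// ltW// exprh_gt0.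
rewrite lambda_shell; apply: (@le_trans _ _
    (\int[vol]_(z in shell k) (c * (h ^+ k) ^- n.+1)%:E)%E).
  by rewrite integral_cst// [leLHS]EFinM lee_wpmul2l ?lee_fin//;
    exact: volume_shell_ge.
apply: ge0_le_integral => //.
- exact: measurable_bergman_diag_shell.
move=> z /andP[h1 h2]; rewrite lee_fin bergman_diag_sqnorm ler_wpM2l ?(ltW
  c0)//.
have rho0 : 0 < 1 - sqnorm z by apply: lt_trans h1; exact: exprh_gt0.
rewrite lef_pV2 ?posrE ?exprn_gt0 ?exprh_gt0//.
by rewrite lerXn2r ?nnegrE ?(ltW rho0)// ltW// exprh_gt0.
Qed.

(** Equal to [berezin] on the ball by [berezin_dirac0], but real-valued and measurable on the whole
    space. *)
Definition berezin_real (z : Cn) : R := c * (1 - sqnorm z) ^+ n.+1.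

Lemma measurable_berezin_real : measurable_fun setT berezin_real.
Proof.
apply: measurable_funM => //; apply: measurable_funX;
  apply: measurable_funB => //.
exact: measurable_sqnorm.
Qed.

Lemma integral_berezin_pow p :
  (\int[lam]_(z in B) (berezin (\d_(0%R : Cn)) z `^ p) =
   \sum_(0 <= k <oo) \int[lam]_(z in shell k) (berezin_real z `^ p)%:E)%E.
Proof.
transitivity (\int[lam]_(z in B) (berezin_real z `^ p)%:E)%E.
  by apply: eq_integral => z /set_mem Bz; rewrite berezin_dirac0// poweR_EFin.
rewrite uball_shell ge0_integral_bigcup//.
- by move=> k; exact: measurable_shell.
- apply/measurable_EFinP; apply: measurable_funTS.
  by apply: (measurableT_comp (measurable_powR _));
    exact: measurable_berezin_real.
- by move=> z _; rewrite lee_fin powR_ge0.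
- exact: trivIset_shell.
Qed.

Lemma powR_exprn (x : R) m p : 0 <= x -> (x ^+ m) `^ p = (x `^ p) ^+ m.
Proof.
by move=> x0; rewrite -(powR_mulrn m x0) -(powR_mulrn m (powR_ge0 x p)) powRAC.
Qed.

(** The ratio between consecutive shells: (h^p)^(n+1) comes from the integrand, h^-(n+1) from the
    density K(z, z) and h from the volume. *)
Lemma powR_ratio p : (h `^ p) ^+ n.+1 / h ^+ n = h `^ (p * n.+1%:R - n%:R).
Proof.
rewrite powRB; last by rewrite invr_eq0 pnatr_eq0 implybT.
by rewrite powRrM !powR_mulrn ?powR_ge0// invr_ge0.
Qed.

Lemma integral_shell_le p k : 0 < p ->
  (\int[lam]_(z in shell k) (berezin_real z `^ p)%:E <=
   (c `^ p * c * h ^- n.+1 * (n%:R * h * V) * (h `^ (p * n.+1%:R - n%:R)) ^+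
     k)%:E)%E.
Proof.
move=> p0; have c0 := bergman_cst_gt0 R n; have mS := @measurable_shell R n k.
apply: (@le_trans _ _ (\int[lam]_(z in shell k) ((c * (h ^+ k) ^+ n.+1) `^
  p)%:E)%E).
  apply: ge0_le_integral => //.
  - by move=> z _; rewrite lee_fin powR_ge0.
  - apply/measurable_EFinP; apply: measurable_funTS.
    by apply: (measurableT_comp (measurable_powR _));
      exact: measurable_berezin_real.
  move=> z /andP[h1 h2]; rewrite lee_fin.
  have rho0 : 0 < 1 - sqnorm z by apply: lt_trans h1; exact: exprh_gt0.
  have hk0 := exprh_gt0 R k.
  rewrite ge0_ler_powR ?nnegrE ?mulr_ge0 ?exprn_ge0 ?(ltW p0) ?(ltW c0) ?(ltW
    rho0) ?(ltW hk0)//.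
  by rewrite ler_wpM2l ?(ltW c0)// lerXn2r ?nnegrE ?(ltW rho0) ?(ltW hk0).
have w0 : (0 <= ((c * (h ^+ k) ^+ n.+1) `^ p)%:E)%E by rewrite lee_fin powR_ge0.
rewrite integral_cst//; apply: le_trans (lee_wpmul2l w0 (lambda_shell_le k)) _.
rewrite -EFinM lee_fin le_eqVlt; apply/orP; left; apply/eqP.
rewrite powRM ?(ltW c0) ?exprn_ge0 ?(ltW (exprh_gt0 _ _))//.
rewrite !powR_exprn ?exprn_ge0 ?invr_ge0// -powR_ratio expr_div_n.
rewrite [(_ ^+ n.+1) ^+ k]exprAC [(h ^+ n) ^+ k]exprAC [h ^+ k.+1]exprS.
(* With X = h^k, Y = (h^p)^k and Z = X^n as independent variables the equality becomes a rational
   identity. *)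
have X0 := exprh_gt0 R k; have Xn0 : 0 < (h ^+ k) ^+ n by rewrite exprn_gt0.
move: Xn0 X0; rewrite exprMn; move: (h ^+ k) (h `^ p ^+ k) => X Y Xn0 X0.
rewrite [X ^+ n.+1]exprS; move: Xn0; move: (X ^+ n) => Z Z0.
by field; rewrite !gt_eqF ?exprn_gt0 ?invr_gt0.
Qed.

Lemma integral_shell_ge p k : 0 < p ->
  ((c `^ p * c * (h `^ p) ^+ n.+1 * (h * h ^+ n.-1 * V) *
     (h `^ (p * n.+1%:R - n%:R)) ^+ k)%:E <=
   \int[lam]_(z in shell k) (berezin_real z `^ p)%:E)%E.
Proof.
move=> p0; have c0 := bergman_cst_gt0 R n; have mS := @measurable_shell R n k.
apply: (@le_trans _ _ (\int[lam]_(z in shell k) ((c * (h ^+ k.+1) ^+ n.+1) `^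
  p)%:E)%E); last first.
  apply: ge0_le_integral => //.
  - by move=> z _; rewrite lee_fin powR_ge0.
  - apply/measurable_EFinP; apply: measurable_funTS.
    by apply: (measurableT_comp (measurable_powR _));
      exact: measurable_berezin_real.
  move=> z /andP[h1 h2]; rewrite lee_fin.
  have rho0 : 0 < 1 - sqnorm z by apply: lt_trans h1; exact: exprh_gt0.
  have hk0 := exprh_gt0 R k.+1.
  rewrite ge0_ler_powR ?nnegrE ?mulr_ge0 ?exprn_ge0 ?(ltW p0) ?(ltW c0) ?(ltW
    rho0) ?(ltW hk0)//.
  by rewrite ler_wpM2l ?(ltW c0)// lerXn2r ?nnegrE ?(ltW rho0) ?(ltW hk0) ?(ltW
    h1).
have w0 : (0 <= ((c * (h ^+ k.+1) ^+ n.+1) `^ p)%:E)%E by rewrite lee_fin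
  powR_ge0.
rewrite integral_cst//; apply: le_trans (lee_wpmul2l w0 (lambda_shell_ge k)).
rewrite -EFinM lee_fin le_eqVlt; apply/orP; left; apply/eqP.
rewrite powRM ?(ltW c0) ?exprn_ge0 ?(ltW (exprh_gt0 _ _))//.
rewrite !powR_exprn ?exprn_ge0 ?invr_ge0// -powR_ratio expr_div_n.
rewrite [(_ ^+ n.+1) ^+ k]exprAC [(h ^+ n) ^+ k]exprAC [h ^+ k.+1]exprS.
rewrite [(h `^ p) ^+ k.+1]exprS exprMn.
have X0 := exprh_gt0 R k; have Xn0 : 0 < (h ^+ k) ^+ n by rewrite exprn_gt0.
move: Xn0 X0; move: (h ^+ k) (h `^ p ^+ k) => X Y Xn0 X0.
rewrite [X ^+ n.+1]exprS; move: Xn0; move: (X ^+ n) => Z Z0.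
by field; rewrite !gt_eqF.
Qed.

(** The exponent (n+1) p - n is nonpositive, so its power of 1/2 is a ratio at least 1. *)
Lemma integral_berezin_oo p : 0 < p -> p <= n%:R / n.+1%:R ->
  (\int[lam]_(z in B) (berezin (\d_(0%R : Cn)) z `^ p) = +oo)%E.
Proof.
move=> p0 pn; rewrite integral_berezin_pow.
have c0 := bergman_cst_gt0 R n; have h0 : 0 < h by rewrite invr_gt0.
apply: nneseries_geometric_oo (fun k => integral_shell_ge k p0).
  by rewrite !mulr_gt0 ?exprn_gt0 ?powR_gt0 ?fine_volume_gt0.
have h01 : 0 < h <= 1 by rewrite h0 invf_le1// ler1n.
have := ger_powR h01 (_ : p * n.+1%:R - n%:R <= 0); rewrite powRr0; apply.
by rewrite subr_le0 -ler_pdivlMr.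
Qed.

Lemma integral_berezin_lty p : n%:R / n.+1%:R < p ->
  (\int[lam]_(z in B) (berezin (\d_(0%R : Cn)) z `^ p) < +oo)%E.
Proof.
move=> pn; have p0 : 0 < p by apply: le_lt_trans pn; rewrite divr_ge0.
have c0 := bergman_cst_gt0 R n; have h0 : 0 < h by rewrite invr_gt0.
rewrite integral_berezin_pow.
apply: nneseries_geometric_lty (fun k => integral_shell_le k p0).
- by rewrite !mulr_ge0 ?invr_ge0 ?exprn_ge0 ?powR_ge0 ?(ltW c0) ?(ltW h0)//
  ltW// fine_volume_gt0.
- exact: powR_ge0.
- have e0 : 0 < p * n.+1%:R - n%:R by rewrite subr_gt0 -ltr_pdivrMr.
  have h1 : h < 1 by rewrite invf_lt1// ltr1n.
  have := gt0_ltr_powR e0 _ _ h1; rewrite powR1; apply; rewrite nnegrE ?ler01//.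
- by move=> k; apply: integral_ge0 => z _; rewrite lee_fin powR_ge0.
Qed.

Lemma Lp_lambda_berezin p : 0 < p ->
  Lp_lambda p (berezin (\d_(0%R : Cn))) <-> n%:R / n.+1%:R < p.
Proof.
move=> p0.
have absE : (\int[lam]_(z in B) (`|berezin (\d_(0%R : Cn)) z| `^ p) =
    \int[lam]_(z in B) (berezin (\d_(0%R : Cn)) z `^ p))%E.
  apply: eq_integral => z /set_mem Bz; rewrite berezin_dirac0//=.
  rewrite ger0_norm// mulr_ge0 ?(ltW (bergman_cst_gt0 R n))// exprn_ge0//.
  by rewrite subr_ge0 ltW.
rewrite /Lp_lambda absE; split=> [[_]|pn].
  by rewrite ltNge => oo; rewrite ltNge; apply: contra oo =>
    /(integral_berezin_oo p0) ->.
split; last exact: integral_berezin_lty.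
apply: (eq_measurable_fun (EFin \o berezin_real)).
  by move=> z /set_mem Bz; rewrite berezin_dirac0.
by apply/measurable_EFinP; apply: measurable_funTS;
  exact: measurable_berezin_real.
Qed.

End berezin_integral.
(** * The Toeplitz operator of the point mass *)

Section toeplitz_dirac.
Variables (R : realType) (n : nat) (n_gt0 : (0 < n)%N).
Local Notation C := R[i].
Local Notation Cn := 'rV[C]_n.
Local Notation normc := (@Normc.normc R).
Local Notation vol := (volume R n).
Local Notation B := (@uball R n).
Local Notation c := (bergman_cst R n).
Local Notation V := (fine (vol B)).
Local Notation T := (@toeplitz R n (\d_(0 : Cn))).
Local Notation H := (@A2 R n).
Local Notation ip := (@ipA2 R n).

(** The constant 1 as an element of [A2], whose members vanish off the ball; it spans the range of
    the operator. *)
Definition one_uball : Cn -> C := extend0 (fun=> 1).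
Local Notation one := one_uball.

Lemma one_uballE z : B z -> one z = 1.
Proof. by move=> Bz; rewrite /one /extend0 mem_set. Qed.

Lemma one_uball0 : one 0 = 1.
Proof. by rewrite one_uballE//; exact: uball0. Qed.

Lemma extend0_cst (a : C) : extend0 (fun=> a) = a *: one :> (Cn -> C).
Proof.
apply/funext => z; rewrite fctE /one /extend0; case: ifPn => _.
  by rewrite -[RHS]/(a * 1) mulr1.
by rewrite -[RHS]/(a * 0) mulr0.
Qed.

Lemma A2_one_uball (a : C) : H (a *: one).
Proof. by rewrite -extend0_cst; exact: A2_cst. Qed.

Lemma A2_cmeasurable (f : Cn -> C) : H f -> cmeasurable setT f.
Proof. exact: A2_measurable. Qed.

Lemma toeplitz_dirac0 (f : Cn -> C) : cmeasurable setT f ->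
  T f = (f 0 * c%:C%C) *: one.
Proof.
move=> mf; rewrite -extend0_cst; apply/funext => z; rewrite /toeplitz /extend0.
case: ifPn => // _.
have [mR mI] : cmeasurable setT (fun w => f w * bergman z w).
  by apply: cmeasurableM => //; exact: cmeasurable_bergmanr.
have mB := @measurable_uball R n.
have dirE (g : Cn -> R) : measurable_fun setT g ->
    (\int[\d_(0 : Cn)]_(w in B) g w)%R = g 0.
  move=> mg; rewrite /Rintegral integral_dirac//; last first.
    by apply/measurable_EFinP; exact: measurable_funTS.
  by rewrite diracE mem_set ?mul1e//; exact: uball0.
by rewrite /cintegral !dirE// bergmanz0; case: (f 0 * _).
Qed.

Lemma cmeasurableZ (a : C) (f : Cn -> C) : cmeasurable setT f ->
  cmeasurable setT (a *: f).
Proof. by apply: cmeasurableM; exact: cmeasurable_cst. Qed.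

Lemma linear_toeplitz : linear_operator H T.
Proof.
split=> [f /A2_cmeasurable mf|a f g /A2_cmeasurable mf /A2_cmeasurable mg].
  by rewrite (toeplitz_dirac0 mf); exact: A2_one_uball.
have mfg : cmeasurable setT (a *: f + g).
  by apply: cmeasurableD => //; exact: cmeasurableZ.
rewrite (toeplitz_dirac0 mf) (toeplitz_dirac0 mg) (toeplitz_dirac0 mfg).
rewrite -[(a *: f + g) 0]/(a * f 0 + g 0).
by move: (f 0) (g 0) (c%:C%C) => x y k; rewrite mulrDl scalerDl -mulrA scalerA.
Qed.

Lemma bergman_cst_neq0 : c%:C%C != 0 :> C.
Proof. by rewrite (fmorph_eq0 (real_complex R)) gt_eqF// bergman_cst_gt0. Qed.

Lemma scale_one_eq0 (a : C) : a *: one = 0 -> a = 0.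
Proof.
move/(congr1 (fun f : Cn -> C => f 0)); rewrite -[LHS]/(a * one 0) one_uball0.
by rewrite mulr1.
Qed.

Lemma has_dim_line (W : set (Cn -> C)) :
  (forall f, W f <-> exists a, f = a *: one) -> has_dim W 1.
Proof.
move=> WE; exists (fun=> one); split.
  apply/seteqP; split=> f /=.
    by move=> /WE[a ->]; exists (fun=> a); rewrite // big_ord1.
  by move=> [a _ <-]; apply/WE; exists (a ord0); rewrite big_ord1.
by move=> a; rewrite big_ord1 => /scale_one_eq0 a0 j; rewrite ord1.
Qed.

Lemma has_rank_toeplitz : has_rank H T 1.
Proof.
apply: has_dim_line => f; split=> [[g Hg <-]|[a ->]].
  by exists (g 0 * c%:C%C); exact: toeplitz_dirac0 (A2_cmeasurable Hg).
exists ((a / c%:C%C) *: one); first exact: A2_one_uball.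
rewrite (toeplitz_dirac0 (A2_cmeasurable (A2_one_uball _))).
rewrite -[_ 0]/(a / _ * one 0) one_uball0 mulr1 mulfVK//.
exact: bergman_cst_neq0.
Qed.

(** The real and imaginary parts of f b and of b conj(f) are all real combinations of this form, so
    one computation serves both slots of the inner product. *)
Lemma A2_Rintegral (x y : R) (f : Cn -> C) : H f ->
  (\int[vol]_(z in B) (x * complex.Re (f z) + y * complex.Im (f z)))%R =
  (x * complex.Re (f 0) + y * complex.Im (f 0)) * V.
Proof.
move=> Hf; have mB := @measurable_uball R n.
have [iRe iIm] := A2_integrable Hf; have [mvRe mvIm] := A2_mean_value Hf.
have {}iRe : vol.-integrable B (EFin \o (fun z => complex.Re (f z))).
  exact: integrableS iRe.
have {}iIm : vol.-integrable B (EFin \o (fun z => complex.Im (f z))).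
  exact: integrableS iIm.
have ix : vol.-integrable B (EFin \o (fun z => x * complex.Re (f z))).
  by have := integrableZl mB x iRe.
have iy : vol.-integrable B (EFin \o (fun z => y * complex.Im (f z))).
  by have := integrableZl mB y iIm.
rewrite RintegralD// !RintegralZl// /Rintegral mvRe mvIm fine_volumeE -!EFinM/=.
by rewrite mulrDl !mulrA.
Qed.

Lemma cintegral_A2_mul (f : Cn -> C) (b : C) : H f ->
  cintegral vol B (fun z => f z * b) = f 0 * b * V%:C%C.
Proof.
move=> Hf; case: b => x y; apply/eqP; rewrite eq_complex; apply/andP; split.
  rewrite /cintegral /=; under eq_Rintegral => z _.
    rewrite (_ : complex.Re _ = x * complex.Re (f z) + - y * complex.Im (f z));
      last first.
      by case: (f z) => u v /=; ring.
    over.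
  rewrite A2_Rintegral//; case: (f 0) => u v /=; apply/eqP; ring.
rewrite /cintegral /=; under eq_Rintegral => z _.
  rewrite (_ : complex.Im _ = y * complex.Re (f z) + x * complex.Im (f z));
    last first.
    by case: (f z) => u v /=; ring.
  over.
rewrite A2_Rintegral//; case: (f 0) => u v /=; apply/eqP; ring.
Qed.

Lemma cintegral_A2_conj (f : Cn -> C) (b : C) : H f ->
  cintegral vol B (fun z => b * conjc (f z)) = b * conjc (f 0) * V%:C%C.
Proof.
move=> Hf; case: b => x y; apply/eqP; rewrite eq_complex; apply/andP; split.
  rewrite /cintegral /=; under eq_Rintegral => z _.
    rewrite (_ : complex.Re _ = x * complex.Re (f z) + y * complex.Im (f z));
      last first.
      by case: (f z) => u v /=; ring.
    over.
  rewrite A2_Rintegral//; case: (f 0) => u v /=; apply/eqP; ring.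
rewrite /cintegral /=; under eq_Rintegral => z _.
  rewrite (_ : complex.Im _ = y * complex.Re (f z) + - x * complex.Im (f z));
    last first.
    by case: (f z) => u v /=; ring.
  over.
rewrite A2_Rintegral//; case: (f 0) => u v /=; apply/eqP; ring.
Qed.

Lemma eq_cintegral (f g : Cn -> C) : (forall z, B z -> f z = g z) ->
  cintegral vol B f = cintegral vol B g.
Proof.
move=> fg; rewrite /cintegral.
by congr (_ +i* _)%C; apply: eq_Rintegral => z /set_mem /fg ->.
Qed.

Lemma ip_one_l (b : C) g : H g -> ip (b *: one) g = b * conjc (g 0) * V%:C%C.
Proof.
move=> Hg; rewrite -cintegral_A2_conj//; apply: eq_cintegral => z Bz.
by rewrite -[(b *: one) z]/(b * one z) one_uballE// mulr1.
Qed.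

Lemma ip_one_r (b : C) f : H f -> ip f (b *: one) = f 0 * conjc b * V%:C%C.
Proof.
move=> Hf; rewrite -cintegral_A2_mul//; apply: eq_cintegral => z Bz.
by rewrite -[(b *: one) z]/(b * one z) one_uballE// mulr1.
Qed.

(** Both sides reduce to c V f(0) conj(g(0)), since c is real. *)
Lemma adjoint_toeplitz : adjoint_operator ip H T T.
Proof.
split; first exact: linear_toeplitz.
move=> f g Hf Hg; rewrite (toeplitz_dirac0 (A2_cmeasurable Hf))
  (toeplitz_dirac0 (A2_cmeasurable Hg)).
rewrite (ip_one_l _ Hg) (ip_one_r _ Hf).
have -> : conjc (g 0 * c%:C%C) = conjc (g 0) * c%:C%C.
  by case: (g 0) => x y; apply/eqP; rewrite eq_complex/=;
    apply/andP; split; apply/eqP; ring.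
by move: (f 0) (conjc _) (c%:C%C) (V%:C%C) => x y k v; ring.
Qed.

Lemma ipnorm_one (b : C) : ipnorm ip (b *: one) = normc b * Num.sqrt V.
Proof.
rewrite /ipnorm ip_one_l; last exact: A2_one_uball.
rewrite -[(b *: one) 0]/(b * one 0) one_uball0 mulr1.
have -> : complex.Re (b * conjc b * V%:C%C) = normc b ^+ 2 * V.
  by rewrite sqr_normcE; case: b => x y /=; ring.
by rewrite sqrtrM ?sqr_ge0// sqrtr_sqr ger0_norm// normc_ge0.
Qed.

(** The inner product uses real integrals, defined through [fine]; square integrability makes the
    extended integral finite, so nothing is lost. *)
Lemma ipnorm_sqr f : H f ->
  ((ipnorm ip f ^+ 2)%:E = \int[vol]_(z in B) (normc (f z) ^+ 2)%:E)%E.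
Proof.
move=> Hf; have [_ [_ _ fin] _] := Hf.
rewrite /ipnorm sqr_sqrtr/=.
  rewrite /ipA2 /cintegral /= /Rintegral fineK; last first.
    rewrite (eq_integral (fun z => (normc (f z) ^+ 2)%:E)) => [|z _].
      by rewrite ge0_fin_numE//; apply: integral_ge0 => z _;
        rewrite lee_fin sqr_ge0.
    by rewrite sqr_normcE; case: (f z) => x y /=; congr EFin; ring.
  apply: eq_integral => z _; rewrite sqr_normcE; case: (f z) => x y /=.
  by congr EFin; ring.
apply: Rintegral_ge0 => z _; case: (f z) => x y /=; rewrite mulrN opprK -!expr2.
by rewrite addr_ge0 ?sqr_ge0.
Qed.

(** The mean value property writes f(0) as c times an integral, bounded through |h| <= |f|^2 + 1.
    Boundedness of f(0) on norm-bounded sets is what compactness requires. *)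
Lemma A2_eval0_bound f M : H f -> ipnorm ip f <= M ->
  `|complex.Re (f 0)| <= (M ^+ 2 + V) * c /\ `|complex.Im (f 0)| <=
    (M ^+ 2 + V) * c.
Proof.
move=> Hf fM; have mB := @measurable_uball R n.
have V0 := fine_volume_gt0 R n.
have M0 : 0 <= M by apply: le_trans fM; exact: sqrtr_ge0.
have [mRe mIm] := A2_measurable Hf; have [mvRe mvIm] := A2_mean_value Hf.
have bnd (h : Cn -> R) : measurable_fun setT h -> (forall z,
  `|h z| <= normc (f z)) ->
    (\int[vol]_(z in B) (h z)%:E = (h 0)%:E * vol B)%E -> `|h 0| <=
      (M ^+ 2 + V) * c.
  move=> mh hf mv; rewrite /bergman_cst ler_pdivlMr//.
  rewrite -lee_fin EFinM EFinD -fine_volumeE.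
  apply: (@le_trans _ _ (\int[vol]_(z in B) `|h z|%:E)%E).
    have -> : (`|h 0|%:E * vol B = `|\int[vol]_(z in B) (h z)%:E|)%E.
      by rewrite mv abseM/= (gee0_abs (measure_ge0 vol B)).
    apply: le_abse_integral => //.
    by apply/measurable_EFinP; exact: measurable_funTS.
  apply: (le_trans (A2_integral_le Hf mh hf));
    rewrite leeD2r// -ipnorm_sqr// lee_fin.
  by rewrite lerXn2r ?nnegrE ?sqrtr_ge0.
split; [apply: (bnd (fun z => complex.Re (f z)))|apply: (bnd (fun z =>
  complex.Im (f z)))] => // z.
  exact: normr_Re_le.
exact: normr_Im_le.
Qed.

End toeplitz_dirac.

(** * Extraction of subsequences *)

Lemma increasing_seq_ge (phi : nat -> nat) : {homo phi : j k / (j < k)%N} ->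
  forall k, (k <= phi k)%N.
Proof.
move=> incr; elim=> // k IH; apply: leq_ltn_trans IH _; exact: incr.
Qed.

Lemma cvg_subseq (R : realType) (u : nat -> R) (l : R) (phi : nat -> nat) :
  {homo phi : j k / (j < k)%N} -> u k @[k --> \oo] --> l ->
  u (phi k) @[k --> \oo] --> l.
Proof.
move=> incr ul; apply: (cvg_comp phi u _ ul) => A [N _ NA].
by exists N => // k /= Nk; apply: NA => /=; exact: leq_trans (increasing_seq_ge
  incr k).
Qed.

Lemma bounded_subseq (R : realType) (u : nat -> R) (M : R) :
  (forall k, `|u k| <= M) -> exists (phi : nat -> nat) (l : R),
    {homo phi : j k / (j < k)%N} /\ u (phi k) @[k --> \oo] --> l.
Proof.
move=> uM; have /bolzano_weierstrass[phi incr cv] : bounded_fun u.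
  exists M; split; first exact: num_real.
  by move=> x Mx k _ /=; exact: le_trans (uM k) (ltW Mx).
exists phi, (limn (u \o phi)); split => //.
by move=> j k; rewrite !ltnNge; apply: contra; have := incr k j;
  rewrite leEnat => ->.
Qed.

(** * Compactness, singular values and Schatten classes *)

Section toeplitz_schatten.
Variables (R : realType) (n : nat) (n_gt0 : (0 < n)%N).
Local Notation C := R[i].
Local Notation Cn := 'rV[C]_n.
Local Notation normc := (@Normc.normc R).
Local Notation vol := (volume R n).
Local Notation B := (@uball R n).
Local Notation c := (bergman_cst R n).
Local Notation V := (fine (vol B)).
Local Notation T := (@toeplitz R n (\d_(0 : Cn))).
Local Notation H := (@A2 R n).
Local Notation ip := (@ipA2 R n).
Local Notation one := (@one_uball R n).

(** The image of u_k depends only on the number u_k(0), which stays bounded; Bolzano-Weierstrass is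
    applied to its real part, then to its imaginary part along the first subsequence. The limit is c
    (x + i y) times [one]. *)
Lemma compact_toeplitz : compact_operator ip H T.
Proof.
split; first exact: linear_toeplitz.
move=> u Hu [M uM].
have bRe k := (A2_eval0_bound (Hu k) (uM k)).1.
have bIm k := (A2_eval0_bound (Hu k) (uM k)).2.
have [phi [x [incr1 cv1]]] := bounded_subseq bRe.
have [psi [y [incr2 cv2]]] := bounded_subseq (fun k => bIm (phi k)).
have {}cv1 := cvg_subseq incr2 cv1.
exists (phi \o psi), (((x +i* y)%C * c%:C%C) *: one).
split; first by move=> j k jk; apply: incr1; exact: incr2.
  exact: A2_one_uball.
pose e k := `|complex.Re (u (phi (psi k)) 0) - x| + `|complex.Im (u (phi (psi
  k)) 0) - y|.
have e0 : e k @[k --> \oo] --> (0 : R).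
  rewrite -[X in _ --> X](addr0 (0 : R)).
  apply: cvgD; apply/cvgrPdist_lt => d d0.
    move/cvgrPdist_lt : cv1 => /(_ d d0); apply: filterS => k.
    by rewrite sub0r normrN normr_id distrC.
  move/cvgrPdist_lt : cv2 => /(_ d d0); apply: filterS => k.
  by rewrite sub0r normrN normr_id distrC.
have ipE k : ipnorm ip (T (u (phi (psi k))) - ((x +i* y)%C * c%:C%C) *: one) =
    normc ((u (phi (psi k)) 0 - (x +i* y)%C) * c%:C%C) * Num.sqrt V.
  rewrite (toeplitz_dirac0 (A2_cmeasurable (Hu _))) -ipnorm_one;
    congr (ipnorm _ _).
  by move: (u _ 0) (x +i* y)%C (c%:C%C) => a b k'; rewrite mulrBl scalerBl.
have K0 : 0 <= normc c%:C%C * Num.sqrt V by rewrite mulr_ge0 ?normc_ge0//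
  sqrtr_ge0.
apply: (@squeeze_cvgr _ _ _ _ (cst 0) (fun k =>
  e k * (normc c%:C%C * Num.sqrt V))).
- apply: nearW => k /=; rewrite ipE Normc.normcM -mulrA.
  rewrite mulr_ge0 ?normc_ge0//= ler_wpM2r//.
  apply: le_trans (normc_le_ReIm _) _; rewrite /e.
  by case: (u _ 0) => a b /=.
- exact: cvg_cst.
- rewrite -[X in _ --> X](mul0r (normc c%:C%C * Num.sqrt V)).
  by apply: cvgM => //; exact: cvg_cst.
Qed.

Lemma toeplitz_sqr f : H f -> T (T f) = (c ^+ 2)%:C%C *: (f 0 *: one).
Proof.
move=> Hf; rewrite (toeplitz_dirac0 (A2_cmeasurable Hf)).
rewrite (toeplitz_dirac0 (A2_cmeasurable (A2_one_uball n _))).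
rewrite -[(_ *: one) 0]/(f 0 * c%:C%C * one 0) one_uball0 mulr1 scalerA.
congr (_ *: _); rewrite rmorphXn/=; move: (f 0) (c%:C%C) => a b; ring.
Qed.

(** The square of the operator is f |-> c^2 f(0) 1. For t = c the eigenspace is the line of
    constants, matching the single index where the sequence equals c; for any other t > 0 both sides
    are empty of content, with dimension and count 0. *)
Lemma singular_values_toeplitz :
  singular_values ip H T (fun k => if k is 0%N then c else 0).
Proof.
have c0 := bergman_cst_gt0 R n.
exists T; first exact: adjoint_toeplitz.
split.
- by apply/nonincreasing_seqP => -[|k] //=; exact: ltW.
- by case=> [|k] //; exact: ltW.
move=> t t0; have [tc|tc] := eqVneq t c.
  exists 1%N.
    apply: has_dim_line => f; split=> [[Hf]|[a ->]].
      rewrite (toeplitz_sqr Hf) tc => /(scalerI _) E; exists (f 0).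
      by rewrite E//(fmorph_eq0 (real_complex R)) expf_neq0// gt_eqF.
    split; first exact: A2_one_uball.
    rewrite (toeplitz_sqr (A2_one_uball n _)) tc.
    by rewrite -[(a *: one) 0]/(a * one 0) one_uball0 mulr1.
  rewrite (_ : mkset _ = `I_1); first exact: card_eqxx.
  apply/seteqP; split=> -[|k]//=; rewrite tc//.
  by move=> /esym/eqP; rewrite gt_eqF.
exists 0%N.
  exists (fun=> 0); split; last by move=> a _ [].
  have t20 : (t ^+ 2)%:C%C != 0 :> C.
    by rewrite (fmorph_eq0 (real_complex R)) expf_neq0// gt_eqF.
  have H0 : H 0 by rewrite -(scale0r one); exact: A2_one_uball.
  apply/seteqP; split=> f /=.
    (* Evaluating the eigenvalue equation at the origin gives (c^2 - t^2) f(0) = 0, hence f(0) = 0;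
       the equation then says t^2 f = 0. *)
    move=> [Hf]; rewrite (toeplitz_sqr Hf) => E; exists (fun=> 0) => //.
    rewrite big_ord0; have := congr1 (fun g : Cn -> C => g 0) E.
    rewrite -[LHS]/((c ^+ 2)%:C%C * (f 0 * one 0)) one_uball0 mulr1.
    rewrite -[RHS]/((t ^+ 2)%:C%C * f 0) => /eqP.
    rewrite -subr_eq0 -mulrBl mulf_eq0 -rmorphB (fmorph_eq0 (real_complex R)).
    rewrite subr_eq0 eqrXn2// ?(ltW c0) ?(ltW t0)// eq_sym (negbTE tc)/= =>
      /eqP f0.
    by move: E; rewrite f0 scale0r scaler0 => /esym/eqP;
      rewrite scaler_eq0 (negbTE t20) => /eqP.
  move=> [a _ <-]; rewrite big_ord0; split => //.
  by rewrite (toeplitz_sqr H0) scaler0 -[(0 : Cn ->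
    C) 0]/(0 : C) scale0r scaler0.
rewrite (_ : mkset _ = set0); first by rewrite II0.
apply/seteqP; split=> -[|k]//= E; first by move: tc; rewrite -E eqxx.
by move: t0; rewrite -E ltxx.
Qed.

Lemma schatten_toeplitz p : 0 < p -> schatten ip H p T.
Proof.
move=> p0; split; first exact: compact_toeplitz.
exists (fun k => if k is 0%N then c else 0); first exact:
  singular_values_toeplitz.
apply: (@nneseries_geometric_lty _ _ (c `^ p) 0) => //.
- exact: powR_ge0.
- by move=> k; rewrite lee_fin powR_ge0.
- case=> [|k]; first by rewrite expr0 mulr1.
  by rewrite expr0n/= mulr0 powR0// gt_eqF.
Qed.

(** Since k_z(0) = c / sqrt K(z, z), the inner product is (c^2 / K(z, z)) (c V), and c V = 1 leaves
    the value of the integral formula. *)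
Lemma berezin_toeplitz z : B z ->
  berezin (\d_(0 : Cn)) z =
    (complex.Re (ip (T (normalized_kernel z)) (normalized_kernel z)))%:E /\
  complex.Im (ip (T (normalized_kernel z)) (normalized_kernel z)) = 0.
Proof.
move=> Bz; have Hk := A2_normalized_kernel Bz; have c0 := bergman_cst_gt0 R n.
have V0 := fine_volume_gt0 R n.
rewrite (toeplitz_dirac0 (A2_cmeasurable Hk)) (ip_one_l _ Hk).
pose s := Num.sqrt (bergman_diag z).
have rho0 : 0 < 1 - sqnorm z by rewrite subr_gt0.
have diag0 : 0 < bergman_diag z.
  by rewrite bergman_diag_sqnorm mulr_gt0// invr_gt0 exprn_gt0.
have k0 : normalized_kernel z 0 = (c / s)%:C%C.
  rewrite /normalized_kernel /extend0 mem_set; last exact: uball0.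
  by rewrite /bergman cdot0l subr0 expr1n invr1 mulr1 -fmorphV -rmorphM.
have -> : normalized_kernel z 0 * c%:C%C * conjc (normalized_kernel z 0) *
  V%:C%C =
    (c / s * c * (c / s) * V)%:C%C.
  rewrite k0; apply/eqP; rewrite eq_complex/=.
  by apply/andP; split; apply/eqP; ring.
split => //=; rewrite berezin_dirac0//; congr EFin.
have s2 : s ^+ 2 = bergman_diag z by rewrite sqr_sqrtr// ltW.
have cV : c * V = 1 by rewrite mulVf// gt_eqF.
transitivity (c ^+ 2 / s ^+ 2 * (c * V)).
  rewrite cV mulr1 s2 bergman_diag_sqnorm.
  by field; rewrite !gt_eqF// exprn_gt0.
by field; rewrite gt_eqF// sqrtr_gt0.
Qed.

End toeplitz_schatten.

(** The third clause ties [berezin], defined by an integral, to the operator. The last one gives the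
    endpoint divergence as the value of an integral, whereas [Lp_lambda] also includes
    measurability. *)
Theorem proposition4p7 (R : realType) (n : nat) (n_gt0 : (0 < n)%N) :
  let mu : {measure set 'rV[R[i]]_n -> \bar R} := \d_(0 : 'rV[R[i]]_n) in
  [/\ has_rank (@A2 R n) (toeplitz mu) 1,
      forall p : R, 0 < p -> schatten (@ipA2 R n) (@A2 R n) p (toeplitz mu),
      forall z : 'rV[R[i]]_n, uball z ->
        berezin mu z =
          (complex.Re (ipA2 (toeplitz mu (normalized_kernel z))
                            (normalized_kernel z)))%:E /\
        complex.Im (ipA2 (toeplitz mu (normalized_kernel z))
                         (normalized_kernel z)) = 0,
      forall p : R, 0 < p ->
        (Lp_lambda p (berezin mu) <-> n%:R / n.+1%:R < p) &
      (\int[@lambda R n]_(z in @uball R n)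
         (berezin mu z `^ (n%:R / n.+1%:R)) = +oo)%E].
Proof.
split.
- exact: has_rank_toeplitz.
- exact: schatten_toeplitz.
- exact: berezin_toeplitz.
- by move=> p p0; exact: Lp_lambda_berezin.
- by apply: integral_berezin_oo => //; rewrite divr_gt0// ltr0n.
Qed.
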